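(* Assume that $E$ satisfies (K2)–(K5) (with data $c,K,\Lambda,\tau$). For $t<\tau$ let $$m(t)=\frac{\det(1+\mathsf K[t])}{\det(1-\mathsf K[t])},$$ and let $\Phi(t,x)$, $\Psi(t,x)$ ($x\in\mathbb R$) be the unique solutions of $$\Phi(t,x)+\int_{-\infty}^tK(x+y)\Phi(t,y)\,dy=1,\qquad \Psi(t,x)-\int_{-\infty}^tK(x+y)\Psi(t,y)\,dy=1.$$ Then $$m(t)=\frac1{\Phi(t,t)}=\Psi(t,t)$$ holds for every $t\in(-\infty,\tau)$.
   Context: Notation: $F^\sharp(z)=\overline{F(\bar z)}$; $(\mathsf Ff)(z)=\int_{-\infty}^\infty f(x)e^{izx}\,dx$; $\mathbf 1_A$ is the characteristic function of $A\subset\mathbb R$; $\ll$ is the Vinogradov symbol; $\det$ is the Fredholm determinant. Conditions on a complex function $E$ (defined at least for $|\Im z|>c$): (K2) There exist $c>0$ and a real-valued continuous function $K$ on $\mathbb R$ such that $|K(x)|\ll\exp(c|x|)$ as $|x|\to\infty$ and $E^\sharp(z)/E(z)=(\mathsf FK)(z)$ for $\Im(z)>c$. (K3) $K$ vanishes on $(-\infty,0)$. (K4) $K$ is continuously differentiable outside a discrete subset $\Lambda\subset\mathbb R$, and $K'\in L^1_{\rm loc}(\mathbb R)$. (K5) There exists $0<\tau\le\infty$ such that neither $+1$ nor $-1$ is an eigenvalue of the operator $\mathsf K[t]:f(x)\mapsto\mathbf 1_{(-\infty,t)}(x)\int_{-\infty}^tK(x+y)f(y)\,dy$ on $L^2(-\infty,t)$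 for every $0\le t<\tau$. Under (K2) and (K3), $\mathsf K[t]$ is well-defined, Hilbert–Schmidt and self-adjoint, and $\mathsf K[t]=0$ for $t\le0$. *)

(* Defs.v *)
From mathcomp Require Export all_boot all_order all_algebra.
From mathcomp Require Export complex.
From mathcomp Require Export all_classical all_reals all_analysis.

Set Implicit Arguments.
Unset Strict Implicit.
Unset Printing Implicit Defensive.

Export Order.TTheory GRing.Theory Num.Theory numFieldNormedType.Exports.

Open Scope classical_set_scope.
Open Scope complex_scope.
Open Scope ring_scope.

Definition cexp (R : realType) (z : R[i]) : R[i] :=
  (expR (complex.Re z))%:C * (cos (complex.Im z) +i* sin (complex.Im z)).

Definition cintegral (R : realType) (D : set R) (f : R -> R[i]) : R[i] :=
  (\int[lebesgue_measure]_(x in D) complex.Re (f x))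
    +i* (\int[lebesgue_measure]_(x in D) complex.Im (f x)).

Definition sharp (R : realType) (F : R[i] -> R[i]) (z : R[i]) : R[i] :=
  ((F (z^*)%C)^*)%C.

Definition fourier (R : realType) (f : R -> R[i]) (z : R[i]) : R[i] :=
  cintegral setT (fun x => f x * cexp ('i%C * z * x%:C)).

(* [E] is a total function of which only the values at |Im z| > c are used. *)
Definition K2 (R : realType) (E : R[i] -> R[i]) (c : R) (K : R -> R) : Prop :=
  [/\ 0 < c,
      continuous K,
      exists A B : R, forall x, B <= `|x| -> `|K x| <= A * expR (c * `|x|) &
      forall z : R[i], c < complex.Im z ->
        E z != 0 /\ sharp E z / E z = fourier (fun x => (K x)%:C) z].

Definition K3 (R : realType) (K : R -> R) : Prop := forall x, x < 0 -> K x = 0.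

(* The values of [derive1 K] on [Lam], which is countable, are irrelevant. *)
Definition K4 (R : realType) (K : R -> R) (Lam : set R) : Prop :=
  [/\ Lam `<=` isolated Lam,
      forall x, ~ Lam x -> derivable K x 1,
      {within ~` Lam, continuous (derive1 K)} &
      locally_integrable setT (derive1 K)].

(* Functions in L^2(-oo, t) are represented by functions on the whole line,
   of which only the restriction to ]-oo, t[, up to a null set, matters. *)
Definition L2 (R : realType) (t : R) (f : R -> R[i]) : Prop :=
  (fun x => \1_(`]-oo, t[) x * complex.Re (f x)) \in Lfun lebesgue_measure 2%:E /\
  (fun x => \1_(`]-oo, t[) x * complex.Im (f x)) \in Lfun lebesgue_measure 2%:E.

Definition opK (R : realType) (K : R -> R) (t : R) (f : R -> R[i]) (x : R) :
    R[i] :=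
  (\1_(`]-oo, t[) x)%:C *
    cintegral `]-oo, t[ (fun y => (K (x + y))%:C * f y).

Definition eigenvalue_opK (R : realType) (K : R -> R) (t : R) (lam : R[i]) :
    Prop :=
  exists f : R -> R[i],
    [/\ L2 t f,
        ~ {ae (@lebesgue_measure R), forall x, x < t -> f x = 0} &
        {ae (@lebesgue_measure R), forall x, x < t ->
          opK K t f x = lam * f x}].

Definition K5 (R : realType) (K : R -> R) (tau : \bar R) : Prop :=
  (0 < tau)%E /\
  forall t : R, 0 <= t -> (t%:E < tau)%E ->
    ~ eigenvalue_opK K t 1 /\ ~ eigenvalue_opK K t (- 1).

Fixpoint iter_integral (R : realType) (D : set R) (n : nat) (F : seq R -> R) :
    R :=
  if n is n'.+1 then
    \int[lebesgue_measure]_(x in D) iter_integral D n' (fun s => F (x :: s))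
  else F [::].

(* Fredholm determinant det(1 + lam k) of the integral operator on L^2(D) with
   continuous kernel k, given by Fredholm's series
     sum_n lam^n / n! int_{D^n} det (k(x_i, x_j))_{i,j} dx_1 ... dx_n. *)
Definition fredholm_det (R : realType) (D : set R) (k : R -> R -> R) (lam : R) :
    R :=
  lim (series (fun n => lam ^+ n / n`!%:R *
    iter_integral D n (fun s =>
      \det (\matrix_(i < size s, j < size s) k s`_i s`_j))) @ \oo).

Definition det_1addK (R : realType) (K : R -> R) (t : R) : R :=
  fredholm_det `]-oo, t[ (fun x y => K (x + y)) 1.

Definition det_1subK (R : realType) (K : R -> R) (t : R) : R :=
  fredholm_det `]-oo, t[ (fun x y => K (x + y)) (- 1).

Definition m (R : realType) (K : R -> R) (t : R) : R :=
  det_1addK K t / det_1subK K t.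

(* The integrability clause makes the integral meaningful, the value of
   [Rintegral] being arbitrary otherwise. *)
Definition solution (R : realType) (K : R -> R) (eps t : R) (phi : R -> R) :
    Prop :=
  forall x : R,
    (@lebesgue_measure R).-integrable `]-oo, t[
      (fun y => (K (x + y) * phi y)%:E) /\
    phi x + eps * \int[lebesgue_measure]_(y in `]-oo, t[) (K (x + y) * phi y)
      = 1.

(* Main.v *)
Require Import Defs.
From mathcomp Require Import ring lra.
From mathcomp Require Import measurable_realfun.

(** The identity is the limit of an exact identity between determinants of
    finite Hankel matrices.

    Fix [t > 0]. For [x < t] the integrals only involve [y] between [- t] and
    [t], because [K] vanishes on negative numbers. Discretised on [n + 1]
    equidistant nodes of this interval, the integral operator becomes a Hankel
    matrix [H] with entries [kap (i + j)], where [kap i = 0] for [i < n]. If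
    [(1 + H) phi] is the column of ones, Cramer's rule gives
    [det (1 + H) * phi n] as the determinant of [1 + H] with its last column
    replaced by ones. Subtracting consecutive rows reduces that column to a
    basis vector, and the remaining minor is, up to sign, [1 - H'] times a
    unitriangular matrix, where [H'] is again a Hankel matrix of the same
    kernel, sampled at the midpoints of the cells. Hence
    [det (1 + H) * phi n = det (1 - H')] ([hankel_cramer]). The last node being
    [t], the limit reads [det (1 + K_t) * Phi t t = det (1 - K_t)]
    ([fredholm_det_hankel]); replacing [K] by [- K] gives
    [det (1 - K_t) * Psi t t = det (1 + K_t)], and the theorem follows once
    both determinants are known not to vanish.

    Three limits are involved. The determinants converge to the Fredholm
    determinants ([det_grid_cvg]): [det (1 + H)] expands into a sum over tuples
    of nodes ([det_1_add_tuples]), whose terms are Riemann sums of Fredholm's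
    iterated integrals, and Hadamard's inequality dominates the series. The
    solutions of the linear systems converge to solutions of the integral
    equation ([nystrom_limit]): they are equicontinuous after one application
    of the operator, so that limits along an ultrafilter are uniform. By
    contradiction, the same compactness shows that the absence of eigenvalues
    bounds the inverses of the matrices uniformly ([grid_stable]); this gives
    existence of [Phi] and [Psi], and Hadamard's inequality applied to the
    inverse matrices keeps their determinants away from zero
    ([fredholm_det_neq0]).

    Uniqueness concerns solutions about which nothing is assumed but that
    [y |-> K (x + y) * phi y] is integrable for every [x]. Unless [K = 0] this
    already makes [phi] integrable on bounded intervals
    ([integrable_of_kernel_mul]), and the equation then makes it continuous up to
    [t]. *)

Set Implicit Arguments.
Unset Strict Implicit.
Unset Printing Implicit Defensive.

(** * Determinants of perturbations of the identity *)

(** Both sides are the determinant of the block matrix [1, - X; Y, 1],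
    computed by eliminating [Y] or [- X]. *)
Lemma det_1_addmx_mulC (R : comNzRingType) m n (X : 'M[R]_(m, n))
    (Y : 'M[R]_(n, m)) :
  \det (1%:M + X *m Y) = \det (1%:M + Y *m X).
Proof.
have e1 : block_mx 1%:M (- X) Y 1%:M =
    block_mx 1%:M 0 Y 1%:M *m block_mx 1%:M (- X) 0 (1%:M + Y *m X).
  rewrite mulmx_block !(mul1mx, mul0mx, mulmx1, mulmx0, addr0) mulmxN.
  by rewrite addrCA addNr addr0.
have e2 : block_mx 1%:M (- X) Y 1%:M =
    block_mx 1%:M (- X) 0 1%:M *m block_mx (1%:M + X *m Y) 0 Y 1%:M.
  rewrite mulmx_block !(mul1mx, mul0mx, mulmx1, mulmx0, addr0, add0r) mulNmx.
  by rewrite addrK.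
have := congr1 (fun M => \det M) e1; rewrite e2 !det_mulmx.
by rewrite !det_ublock !det_lblock !det1 !mul1r mulr1.
Qed.

(** A principal minor of [A], padded by rows of the identity in order to keep
    the size [n] for all index sets. *)
Definition principal_mx (R : comNzRingType) n (A : 'M[R]_n) (S : {set 'I_n}) :=
  \matrix_(i, j) if i \in S then A i j else (i == j)%:R.

(** In Leibniz' formula, [S] collects the rows where the entry of [A] is chosen
    rather than that of the identity. *)
Lemma det_1_add_principal (R : comNzRingType) n (A : 'M[R]_n) :
  \det (1%:M + A) = \sum_(S : {set 'I_n}) \det (principal_mx A S).
Proof.
rewrite /determinant exchange_big /=; apply: eq_bigr => s _.
rewrite -big_distrr /=; congr (_ * _).
under eq_bigr do rewrite !mxE addrC.
rewrite bigA_distr /=; apply: eq_bigr => S _.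
by apply: eq_bigr => i _; rewrite mxE.
Qed.

(** Let [P] be the 0-1 matrix of [s]. The left-hand side is
    [\det (P *m A *m P^T)]. If [s] is injective then [P *m P^T = 1], and the
    padded minor is [1 + P^T *m P *m (A - 1)], so that the two determinants
    agree by [det_1_addmx_mulC]; otherwise two rows coincide. *)
Lemma det_tuple_sub (R : comNzRingType) n k (A : 'M[R]_n) (s : k.-tuple 'I_n) :
  \det (\matrix_(a < k, b < k) A (tnth s a) (tnth s b)) =
  if uniq s then \det (principal_mx A [set i in s]%SET) else 0.
Proof.
case: tuple_uniqP => [us|nus]; last first.
  have [a [b ab sab]] : exists a, exists2 b, a != b & tnth s a = tnth s b.
    apply: contrapT => H; apply: nus => a b sab; apply/eqP/negPn/negP => ab.
    by apply: H; exists a, b.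
  by apply: (determinant_alternate ab) => j; rewrite !mxE sab.
pose P : 'M[R]_(k, n) := \matrix_(a, i) (tnth s a == i)%:R.
have PA m (B : 'M[R]_(n, m)) : P *m B = \matrix_(a, j) B (tnth s a) j.
  apply/matrixP => a j; rewrite !mxE (bigD1 (tnth s a)) //= mxE eqxx mul1r.
  by rewrite big1 ?addr0// => i; rewrite mxE eq_sym => /negPf ->; rewrite mul0r.
have AP m (B : 'M[R]_(m, n)) : B *m P^T = \matrix_(i, b) B i (tnth s b).
  by apply: trmx_inj; rewrite trmx_mul trmxK PA; apply/matrixP => a j; rewrite !mxE.
have -> : principal_mx A [set i in s]%SET = 1%:M + P^T *m (P *m (A - 1%:M)).
  apply/matrixP => i j; rewrite !mxE inE PA.
  case: ifPn => [/tnthP[a ->]|nis].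
    rewrite (bigD1 a) //= !mxE eqxx mul1r big1 ?addr0; first by rewrite addrC subrK.
    by move=> b ba; rewrite !mxE (inj_eq us) (negPf ba) mul0r.
  rewrite big1 ?addr0// => a _; rewrite !mxE.
  by have [e|] := eqVneq (tnth s a) i; rewrite ?mul0r//; rewrite -e mem_tnth in nis.
rewrite det_1_addmx_mulC mulmxBr mulmx1 mulmxBl [P *m P^T]AP.
have -> : \matrix_(i, b) P i (tnth s b) = 1%:M.
  by apply/matrixP => a b; rewrite !mxE (inj_eq us).
by rewrite addrC subrK AP; congr (\det _); apply/matrixP => a b; rewrite PA !mxE.
Qed.

(** A set of [k] indices is the range of exactly [k!] injective tuples. *)
Lemma sum_tuple_det (R : comNzRingType) n k (A : 'M[R]_n) :
  \sum_(s : k.-tuple 'I_n) \det (\matrix_(a < k, b < k) A (tnth s a) (tnth s b))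
  = k`!%:R * \sum_(S : {set 'I_n} | #|S| == k) \det (principal_mx A S).
Proof.
under eq_bigr do rewrite det_tuple_sub.
rewrite -big_mkcond /=.
rewrite (partition_big (fun s : k.-tuple 'I_n => [set i in s]%SET)
  (fun S : {set 'I_n} => #|S| == k)) /=; last first.
  by move=> s us; rewrite cardsE (card_uniqP us) size_tuple.
rewrite big_distrr /=; apply: eq_bigr => S /eqP Sk.
rewrite (eq_bigr (fun _ => \det (principal_mx A S))); last first.
  by move=> s /andP[_ /eqP ->].
have -> : k`! = #|finset (fun t : k.-tuple 'I_n => all (mem S) t && uniq t)|.
  by rewrite card_uniq_tuples -[#|_|]/#|S| Sk ffactnn.
rewrite sumr_const [RHS]mulr_natl; congr (_ *+ _); apply: eq_card => s.
rewrite !inE unfold_in; apply/andP/andP => -[]; last first.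
  move=> sS us; split => //.
  rewrite eqEcard Sk cardsE (card_uniqP us) size_tuple leqnn andbT.
  by apply/fintype.subsetP => i; rewrite inE => /(allP sS).
move=> us /eqP sS; split => //.
by apply/allP => i /= si; rewrite -sS inE.
Qed.

(** The discrete form of Fredholm's series. Summing over tuples instead of sets
    makes each term a Riemann sum of an integral over a full cube. *)
Lemma det_1_add_tuples (R : numFieldType) n (A : 'M[R]_n) :
  \det (1%:M + A) = \sum_(k < n.+1) k`!%:R^-1 *
    \sum_(s : k.-tuple 'I_n)
      \det (\matrix_(a < k, b < k) A (tnth s a) (tnth s b)).
Proof.
rewrite det_1_add_principal.
have cS (S : {set 'I_n}) : (#|S| < n.+1)%N.
  by rewrite ltnS -[X in (_ <= X)%N]card_ord max_card.
rewrite (partition_big (fun S : {set 'I_n} => Ordinal (cS S)) predT) //=.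
apply: eq_bigr => k _; rewrite sum_tuple_det mulrA mulVf ?mul1r; last first.
  by rewrite pnatr_eq0 -lt0n fact_gt0.
by apply: eq_bigl => S; rewrite -val_eqE.
Qed.

(** Hadamard's inequality in Gram form. Making the rows orthogonal to the first
    one leaves the Gram determinant unchanged, splits off the factor of that
    row and can only shrink the other diagonal entries. The matrix is
    rectangular since the induction removes rows only. *)
Lemma hadamard_gram (R : realFieldType) n m (A : 'M[R]_(n, m)) :
  0 <= \det (A *m A^T) <= \prod_i (A *m A^T) i i.
Proof.
elim: n A => [|n IHn] A; first by rewrite det_mx00 big_ord0 ler01 lexx.
move: A; rewrite -(add1n n) => A.
have gram_ge0 p q (B : 'M[R]_(p, q)) i : 0 <= (B *m B^T) i i.
  by rewrite mxE; apply: sumr_ge0 => j _; rewrite mxE -expr2 sqr_ge0.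
have [a [B eA]] : exists (a : 'rV[R]_m) (B : 'M[R]_(n, m)), A = col_mx a B.
  by exists (usubmx A), (dsubmx A); rewrite vsubmxK.
pose c := (a *m a^T) 0 0.
have eG : A *m A^T = block_mx (a *m a^T) (a *m B^T) (B *m a^T) (B *m B^T).
  by rewrite {1 2}eA tr_col_mx mul_col_row.
have eP : \prod_i (A *m A^T) i i = c * \prod_i (B *m B^T) i i.
  rewrite eG (@big_split_ord _ _ _ 1 n) /= big_ord1 block_mxEul; congr (_ * _).
  by apply: eq_bigr => i _; rewrite block_mxEdr.
have [c0|c0] := eqVneq c 0.
  have a0 : a = 0.
    apply/rowP => j; rewrite [RHS]mxE; apply/eqP; rewrite -sqrf_eq0; apply/eqP.
    move/eqP: c0; rewrite /c mxE psumr_eq0; last first.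
      by move=> i _; rewrite mxE -expr2 sqr_ge0.
    by move=> /allP/(_ j (mem_index_enum j)) /=; rewrite mxE -expr2 => /eqP.
  rewrite eP c0 mul0r eG a0 !mul0mx det_lblock.
  by rewrite (_ : \det (0 : 'M[R]_1) = 0) ?mul0r ?lexx// det_mx11 mxE.
have cgt0 : 0 < c by rewrite lt_def c0 gram_ge0.
have ec : a *m a^T = c%:M by rewrite [LHS]mx11_scalar.
pose w := c^-1 *: (B *m a^T); pose B' := B - w *m a.
have aB' : a *m B'^T = 0.
  rewrite /B' linearB /= mulmxBr trmx_mul mulmxA ec mul_scalar_mx.
  rewrite [w^T]linearZ /= trmx_mul trmxK scalerA.
  by rewrite mulfV// scale1r subrr.
have B'a : B' *m a^T = 0 by apply: trmx_inj; rewrite trmx_mul trmxK aB' !trmx0.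
have eL : A = block_mx 1%:M 0 w 1%:M *m col_mx a B'.
  by rewrite eA mul_block_col !mul1mx mul0mx addr0 addrC subrK.
have eD : \det (A *m A^T) = c * \det (B' *m B'^T).
  rewrite eL trmx_mul mulmxA -(mulmxA (block_mx _ _ _ _)) !det_mulmx det_tr.
  rewrite !det_lblock !det1 !mul1r mulr1 tr_col_mx mul_col_row aB' B'a.
  by rewrite det_lblock ec det_scalar1.
have [D0 Dle] := andP (IHn B'); rewrite eD eP.
apply/andP; split; first by rewrite mulr_ge0// ltW.
rewrite ler_pM2l// (le_trans Dle)//; apply: ler_prod => i _.
rewrite gram_ge0 /=.
have eB : B = B' + w *m a by rewrite subrK.
clearbody B'; rewrite eB.
rewrite [(B' + _)^T]linearD /= mulmxDl !mulmxDr trmx_mul.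
rewrite (mulmxA B') B'a mul0mx addr0 -(mulmxA w a) aB' mulmx0 add0r.
rewrite mulmxA -(mulmxA w a) ec [leRHS]mxE lerDl mul_mx_scalar -scalemxAl mxE.
by apply: mulr_ge0; rewrite ?gram_ge0// ltW.
Qed.

Lemma hadamard (R : realFieldType) n (A : 'M[R]_n) :
  \det A ^+ 2 <= \prod_i \sum_j A i j ^+ 2.
Proof.
have /andP[_] := hadamard_gram A; rewrite det_mulmx det_tr -expr2.
by under [in leRHS]eq_bigr do rewrite mxE; under [in leRHS]eq_bigr do
  under eq_bigr do rewrite mxE -expr2.
Qed.

Section Hankel.
Variables (R : comNzRingType) (n : nat) (kap : nat -> R).
Hypothesis kap0 : forall i, (i < n)%N -> kap i = 0.

(** The algebraic core of the theorem: it links the last entry of the solution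
    to the determinant with the opposite sign. *)
Lemma hankel_cramer (phi : 'cV[R]_n.+1) :
  (1%:M + \matrix_(i, j < n.+1) kap (i + j)%N) *m phi = const_mx 1 ->
  \det (1%:M + \matrix_(i, j < n.+1) kap (i + j)%N) * phi ord_max 0 =
  \det (1%:M - \matrix_(i, j < n) kap (i + j).+1).
Proof.
set A := (1%:M + _) => Aphi.
have lm (j : 'I_n) : (lift ord_max j == ord_max) = false.
  by rewrite eq_sym (negPf (neq_lift _ _)).
(* Cramer's rule: [A *m Q] is [A] with its last column replaced by ones. *)
pose Q : 'M[R]_n.+1 := \matrix_(i, j) if j == ord_max then phi i 0 else (i == j)%:R.
have detQ : \det Q = phi ord_max 0.
  rewrite (expand_det_row _ ord_max) (bigD1 ord_max) //= big1 ?addr0; last first.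
    by move=> j /negPf jm; rewrite mxE jm eq_sym jm mul0r.
  rewrite mxE eqxx /cofactor addnn -mul2n mulnC exprM sqrr_sign mul1r.
  rewrite (_ : row' _ _ = 1%:M) ?det1 ?mulr1//.
  by apply/matrixP => i j; rewrite !mxE (inj_eq lift_inj) lm.
(* [D] takes differences of consecutive rows, keeping the first row. *)
pose D : 'M[R]_n.+1 := \matrix_(i, j) ((i == j)%:R - (i == j.+1 :> nat)%:R).
have DM p (M : 'M[R]_(n.+1, p)) (i : 'I_n) j :
    (D *m M) (lift ord0 i) j = M (lift ord0 i) j - M (widen_ord (leqnSn n) i) j.
  rewrite mxE; under eq_bigr do rewrite mxE lift0 eqSS mulrBl.
  rewrite sumrB (bigD1 (lift ord0 i)) //= eqxx mul1r big1 ?addr0; last first.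
    by move=> k /negPf; rewrite eq_sym => ->; rewrite mul0r.
  rewrite (bigD1 (widen_ord (leqnSn n) i)) //= eqxx mul1r big1 ?addr0//.
  by move=> k /negPf; rewrite eq_sym -val_eqE /= => ->; rewrite mul0r.
have D0 p (M : 'M[R]_(n.+1, p)) j : (D *m M) ord0 j = M ord0 j.
  rewrite mxE (bigD1 ord0) //= mxE eqxx subr0 mul1r big1 ?addr0//.
  by move=> k /negPf; rewrite mxE eq_sym subr0 => ->; rewrite mul0r.
have detD : \det D = 1.
  rewrite det_trig; last first.
    apply/is_trig_mxP => i j ij; rewrite mxE -val_eqE /= !ltn_eqF ?subrr//.
    by rewrite ltnS ltnW.
  by apply: big1 => i _; rewrite mxE eqxx ltn_eqF ?subr0.
have AQ i : (A *m Q) i ord_max = 1.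
  transitivity ((A *m phi) i 0); last by rewrite Aphi mxE.
  by rewrite !mxE; apply: eq_bigr => j _; rewrite !mxE eqxx.
have AQl i (j : 'I_n) : (A *m Q) i (lift ord_max j) = A i (lift ord_max j).
  rewrite mxE (bigD1 (lift ord_max j)) //= [Q _ _]mxE lm eqxx mulr1.
  by rewrite big1 ?addr0// => k /negPf kj; rewrite [Q _ _]mxE lm kj mulr0.
rewrite -detQ -det_mulmx -[LHS]mul1r -[X in X * _ = _]detD -det_mulmx.
rewrite (expand_det_col _ ord_max) (bigD1 ord0) //= D0 AQ mul1r big1 ?addr0; last first.
  move=> i; case: (unliftP ord0 i) => [k ->|->]; rewrite ?eqxx// => _.
  by rewrite DM !AQ subrr mul0r.
pose U : 'M[R]_n := \matrix_(i, j) ((i == j)%:R - (i.+1 == j :> nat)%:R).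
(* What is left is the minor [B] of [D *m A] without first row and last column.
   Row differences act on a Hankel matrix like column differences, which are
   multiplication by [U] on the right; on the identity they give [- U], the
   removal of a row and a column having shifted the diagonal. *)
rewrite /cofactor add0n.
pose B : 'M[R]_n := row' (ord0 : 'I_n.+1) (col' (ord_max : 'I_n.+1) (D *m (A *m Q))).
rewrite -[row' _ _]/B.
rewrite (_ : B = -1 *: ((1%:M - \matrix_(i, j < n) kap (i + j).+1) *m U)).
  rewrite detZ mulrA -expr2 sqrr_sign mul1r det_mulmx.
  rewrite (_ : \det U = 1) ?mulr1//.
  rewrite -det_tr det_trig; last first.
    apply/is_trig_mxP => i j ij; rewrite !mxE -val_eqE /= !gtn_eqF ?subrr//.
    exact: ltnW.
  by apply: big1 => i _; rewrite !mxE eqxx gtn_eqF ?subr0.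
apply/matrixP => i j.
rewrite mulmxBl mul1mx scalerBr !scaleN1r opprK.
have HU : ((\matrix_(i, j < n) kap (i + j).+1) *m U) i j =
   kap (i + j).+1 - kap (i + j)%N.
  rewrite mxE; under eq_bigr do rewrite mxE [X in _ * X]mxE mulrBr.
  rewrite sumrB (bigD1 j) //= eqxx mulr1 big1 ?addr0; last first.
    by move=> k /negPf ->; rewrite mulr0.
  (* In column 0 the product with [U] has no second term, and [kap i = 0]. *)
  congr (_ - _); have [j0|j0] := posnP j.
    rewrite j0 addn0 kap0// big1// => k _.
    by rewrite gtn_eqF// mulr0.
  have jn : (j.-1 < n)%N by apply: leq_trans (ltn_ord j); rewrite prednK ?leqnSn.
  rewrite (bigD1 (Ordinal jn)) //= prednK// eqxx mulr1 -addnS prednK//.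
  rewrite big1 ?addr0// => k /negPf; rewrite -val_eqE /= => kj.
  by rewrite -[j : nat in X in X%:R](prednK j0) eqSS kj mulr0.
have mE : B i j = (D *m (A *m Q)) (lift ord0 i) (lift ord_max j).
  by rewrite mxE [LHS]mxE.
rewrite mE DM !AQl [RHS]mxE HU [(- U) i j]mxE [U i j]mxE [A (lift _ _) _]mxE.
rewrite [A (widen_ord _ _) _]mxE ![(\matrix_(_, _) _) _ _]mxE.
rewrite ![(1%:M : 'M[R]_(_, _)) _ _]mxE -!val_eqE lift0 lift_max addSn.
have -> : \val (lift ord0 i) = i.+1 by exact: lift0.
have -> : \val (lift (ord_max : 'I_n.+1) j) = j by exact: lift_max.
rewrite [nat_of_ord (widen_ord _ _)]/= [\val (widen_ord _ _)]/=.
ring.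
Qed.
End Hankel.

(** The first row on the left is that of the identity. This presents the
    determinant of size [n] in [hankel_cramer] as one on the [n.+1] cells that
    carry the matrix of size [n.+1]. *)
Lemma det_hankel_pad (R : comNzRingType) n (mu : nat -> R) :
  (forall i, (i <= n)%N -> mu i = 0) ->
  \det (1%:M + \matrix_(i, j < n.+1) mu (i + j)%N) =
  \det (1%:M + \matrix_(i, j < n) mu (i + j).+2).
Proof.
move=> mu0; rewrite (expand_det_row _ ord0) (bigD1 ord0) //= big1 ?addr0.
  rewrite !mxE eqxx mu0// addr0 mul1r /cofactor expr0 mul1r; congr (\det _).
  apply/matrixP => i j; rewrite !mxE (inj_eq lift_inj).
  by rewrite /= /bump /= !add1n addnS addSn.
move=> i /negPf i0; rewrite !mxE eq_sym i0 mu0 ?addr0 ?mul0r//.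
by rewrite add0n -ltnS ltn_ord.
Qed.

(** The hypothesis [AC] bounds the inverse of [1 + H] by [C] in the operator
    norm of the maximum norm. *)
Section InverseBound.
Variables (R : realFieldType) (n : nat) (H : 'M[R]_n) (b C : R).
Hypothesis Hb : forall i j, `|H i j| <= b.
Hypothesis AC : forall (v : 'cV[R]_n) (beta : R),
  (forall i, `|((1%:M + H) *m v) i 0| <= beta) -> forall i, `|v i 0| <= C * beta.

Lemma bounded_below_unitmx : 1%:M + H \in unitmx.
Proof.
rewrite unitmxE unitfE -det_tr; apply/det0P => -[v v0 vA].
have Av : (1%:M + H) *m v^T = 0.
  by apply: trmx_inj; rewrite trmx_mul trmxK trmx0.
case/eqP: v0; apply/rowP => i; apply/eqP; rewrite !mxE -normr_le0.
have := @AC v^T 0 _ i; rewrite mxE mulr0; apply => k.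
by rewrite Av mxE normr0.
Qed.

(** The inverse is [1 + B] with [B = - (1 + H)^-1 *m H], whose entries are at
    most [C * b], and Hadamard's inequality bounds its determinant from above.
    If [b] is of order [1 / n], the power stays bounded as [n] grows. *)
Lemma det_bounded_below : 0 <= C ->
  1 <= \det (1%:M + H) ^+ 2 *
       (1 + 2 * (C * b) + n%:R * (C * b) ^+ 2) ^+ n.
Proof.
move=> C0; have Au := bounded_below_unitmx.
pose A := 1%:M + H; rewrite -/A in Au *; have ACA := AC; rewrite -/A in ACA.
pose B := - (invmx A *m H).
have eB : invmx A = 1%:M + B.
  have e1 : 1%:M = A - H by rewrite addrK.
  by rewrite -[LHS]mulmx1 [X in _ *m X = _]e1 mulmxBr mulVmx.
have Bb i j : `|B i j| <= C * b.
  have := @ACA (col j (invmx A *m H)) b _ i; rewrite !mxE normrN; apply=> k.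
  have -> : (A *m col j (invmx A *m H)) k 0 = (A *m (invmx A *m H)) k j.
    by rewrite [LHS]mxE [RHS]mxE; apply: eq_bigr => l _; rewrite [col _ _ _ _]mxE.
  by rewrite mulKVmx.
have : 1 = \det A ^+ 2 * \det (invmx A) ^+ 2.
  by rewrite -exprMn -det_mulmx mulmxV// det1 expr1n.
move=> {1}->; apply: ler_wpM2l; first exact: sqr_ge0.
apply: (le_trans (hadamard _)); rewrite -[X in _ ^+ X]card_ord -prodr_const.
apply: ler_prod => i _; rewrite sumr_ge0/=; last by move=> j _; exact: sqr_ge0.
have Cb0 : 0 <= C * b by apply: le_trans (normr_ge0 _) (Bb i i).
have eBE k j : invmx A k j = (k == j)%:R + B k j by rewrite eB mxE [1%:M k j]mxE.
under eq_bigr do rewrite eBE.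
rewrite (bigD1 i)//= eqxx.
apply: (@le_trans _ _ (1 + 2 * (C * b) + (C * b) ^+ 2 +
                       \sum_(j < n | j != i) (C * b) ^+ 2)).
  apply: lerD.
    have -> : 1 + 2 * (C * b) + (C * b) ^+ 2 = (1 + C * b) ^+ 2 by ring.
    rewrite -real_normK ?num_real// lerXn2r ?nnegrE ?addr_ge0//.
    by rewrite (le_trans (ler_normD _ _))// normr1 lerD2l.
  apply: ler_sum => j ji; rewrite eq_sym (negPf ji) add0r.
  by rewrite -real_normK ?num_real// lerXn2r// nnegrE.
rewrite -addrA lerD2l.
have -> : n%:R * (C * b) ^+ 2 = \sum_(j < n) (C * b) ^+ 2.
  by rewrite sumr_const card_ord mulr_natl.
by rewrite [leRHS](bigD1 i).
Qed.
End InverseBound.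

(** * Uniformly continuous functions and truncated kernels *)

Definition ucont (R : realType) (f : R -> R) : Prop :=
  forall e, 0 < e -> exists2 d, 0 < d &
    forall x y, `|x - y| <= d -> `|f x - f y| <= e.

Section Ucont.
Context {R : realType}.
Implicit Types (f g : R -> R) (a b e : R).

Lemma ucont_continuous f : ucont f -> continuous f.
Proof.
move=> uf x; apply/cvgrPdist_le => e /uf[d d0 fd]; near=> y.
by apply: fd; near: y; exists d => //= y /ltW.
Unshelve. all: by end_near. Qed.

Lemma ucontM f g A B : ucont f -> ucont g ->
  (forall x, `|f x| <= A) -> (forall x, `|g x| <= B) ->
  ucont (fun x => f x * g x).
Proof.
move=> uf ug fA gB e e0.
have A0 : 0 <= A by exact: le_trans (normr_ge0 _) (fA 0).
have B0 : 0 <= B by exact: le_trans (normr_ge0 _) (gB 0).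
have A1 : 0 < A + B + 1 by rewrite ltr_wpDl// addr_ge0.
have [d1 d10 fd] := uf _ (divr_gt0 e0 A1).
have [d2 d20 gd] := ug _ (divr_gt0 e0 A1).
exists (Num.min d1 d2); first by rewrite lt_min d10.
move=> x y; rewrite le_min => /andP[xy1 xy2].
have -> : f x * g x - f y * g y = f x * (g x - g y) + (f x - f y) * g y by ring.
rewrite (le_trans (ler_normD _ _))// !normrM.
have h1 : `|f x| * `|g x - g y| <= A * (e / (A + B + 1)) by apply: ler_pM => //; exact: gd.
have h2 : `|f x - f y| * `|g y| <= e / (A + B + 1) * B by apply: ler_pM => //; exact: fd.
rewrite (le_trans (lerD h1 h2))// [_ * B]mulrC -mulrDl mulrA ler_pdivrMr// mulrC.
by rewrite ler_pM2l// lerDl.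
Qed.

Lemma ucont_shift f x : ucont f -> ucont (fun y => f (x + y)).
Proof.
move=> uf e /uf[d d0 fd]; exists d => // y z yz.
by apply: fd; rewrite opprD addrACA subrr add0r.
Qed.

Lemma ucontZ c f : ucont f -> ucont (fun x => c * f x).
Proof.
move=> uf e e0; have c1 : 0 < `|c| + 1 by rewrite ltr_wpDl.
have [d d0 fd] := uf _ (divr_gt0 e0 c1); exists d => // x y xy.
rewrite -mulrBr normrM (le_trans (ler_wpM2l _ (fd x y xy)))//.
by rewrite mulrCA ger_pMr// ler_pdivrMr// mul1r lerDl.
Qed.

(** The Heine-Cantor theorem, in the stronger form that constrains only one of
    the two points to the segment. *)
Lemma continuous_ucont_near f a b : continuous f ->
  forall e, 0 < e -> exists2 d, 0 < d &
    forall x y, a <= x <= b -> `|x - y| <= d -> `|f x - f y| <= e.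
Proof.
move=> cf e e0.
have /compact_near_coveringP/(_ _ (0^'+ : set_system R)
  (fun d x => forall y, `|x - y| <= d -> `|f x - f y| <= e)) := @segment_compact R a b.
case=> [x _|d /= d0 fd].
  have e20 : 0 < e / 2 by rewrite divr_gt0.
  have /cvgrPdist_le/(_ (e / 2) e20) := cf x.
  move=> -[d /= d0 fd].
  exists ([set y | `|x - y| < d / 2], [set i | i < d / 2]) => /=.
    split; first by exists (d / 2); rewrite //= divr_gt0.
    by exists (d / 2); rewrite /= ?divr_gt0// => y /=; rewrite sub0r normrN => /ltr_normlW.
  move=> -[x' i] /= [xx' id] y x'y.
  have h1 : `|f x - f x'| <= e / 2 by apply: fd => /=; lra.
  have h2 : `|f x - f y| <= e / 2.
    apply: fd => /=; rewrite -(subrK x' x) -addrA (le_lt_trans (ler_normD _ _))//.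
    lra.
  rewrite -(subrK (f x) (f x')) -addrA (le_trans (ler_normD _ _))// distrC.
  lra.
exists (d / 2); first by rewrite divr_gt0.
move=> x y xab xy; apply: (fd (d / 2)) => //=; rewrite ?divr_gt0//.
by rewrite sub0r normrN gtr0_norm ?divr_gt0//; lra.
Qed.

Variables (K : R -> R) (b : R).
Hypotheses (cK : continuous K) (K0 : forall x, x < 0 -> K x = 0).

(** Truncation on the right, and vanishing on the left, reduce the question to
    the segment from [0] to [b]. *)
Lemma ucont_truncation : ucont (fun x => K (Num.min x b)).
Proof.
move=> e e0; have [d d0 Kd] := @continuous_ucont_near K 0 b cK e e0.
exists d => // x y xy.
have mxy : `|Num.min x b - Num.min y b| <= d.
  apply: le_trans xy; rewrite /Order.min.
  case: ifPn => xb; case: ifPn => yb; rewrite ?subrr ?normr0//.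
    by move: yb; rewrite -leNgt => yb; rewrite !ltr0_norm; lra.
  by move: xb; rewrite -leNgt => xb; rewrite !ger0_norm; lra.
have mb z : Num.min z b <= b by rewrite ge_min lexx orbT.
have [hx|hx] := leP 0 (Num.min x b).
  by apply: Kd => //; rewrite hx mb.
have [hy|hy] := leP 0 (Num.min y b).
  by rewrite distrC; apply: Kd; rewrite ?hy ?mb// distrC.
by rewrite !K0 ?subrr ?normr0 ?ltW.
Qed.

Lemma bounded_truncation : exists2 M, 1 <= M &
  forall x, `|K (Num.min x b)| <= M.
Proof.
have := @compact_bounded _ _ _ (continuous_compact
  (continuous_subspaceT cK : {within `[0, b], continuous K}) (@segment_compact _ _ _)).
move=> [M0 [_ KM]]; pose M := Num.max 1 (M0 + 1).
have M1 : 1 <= M by rewrite le_max lexx.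
exists M => // x; have [hx|hx] := leP 0 (Num.min x b).
  apply: (KM M); first by rewrite lt_max ltrDl ltr01 orbT.
  by exists (Num.min x b) => //=; rewrite in_itv /= hx ge_min lexx orbT.
by rewrite K0 ?normr0 ?(le_trans ler01).
Qed.
End Ucont.

(** * Riemann sums *)

Section Integral.
Context {R : realType}.
Notation mu := (@lebesgue_measure R).
Implicit Types (G : R -> R) (a b : R).

Lemma integrable_continuous G a b : continuous G ->
  mu.-integrable `[a, b[ (EFin \o G).
Proof.
move=> cG; apply: (@integrableS _ _ _ mu `[a, b]%classic) => //.
  by move=> x /=; rewrite !in_itv /= => /andP[-> /ltW].
apply: continuous_compact_integrable; first exact: segment_compact.
exact: continuous_subspaceT.
Qed.

Lemma Rintegral_cst_itv a b v : a <= b ->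
  \int[mu]_(x in `[a, b[) v = v * (b - a).
Proof.
move=> ab; rewrite Rintegral_cst//; congr (_ * _).
apply: (etrans (congr1 fine (lebesgue_measure_itv (`[a, b[%O : interval R)))).
rewrite /= lte_fin; have [//|ba] := ltP a b.
by rewrite (_ : b = a) ?subrr//; apply/le_anti/andP.
Qed.

Lemma Rintegral_cell G a b v e : continuous G -> a <= b ->
  (forall x, a <= x < b -> `|G x - v| <= e) ->
  `|\int[mu]_(x in `[a, b[) G x - (b - a) * v| <= e * (b - a).
Proof.
move=> cG ab Gv; have cc (c : R) : continuous (fun _ : R => c) by move=> ?; exact: cvg_cst.
have i1 := @integrable_continuous G a b cG.
have iv c := @integrable_continuous (fun _ : R => c) a b (cc c).
rewrite mulrC -(Rintegral_cst_itv v ab) -RintegralB//.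
have iB : mu.-integrable `[a, b[ (EFin \o (fun x => G x - v)).
  by apply: integrable_continuous => x; apply: cvgB; [exact: cG|exact: cvg_cst].
rewrite (le_trans (le_normr_Rintegral _ _))// -(Rintegral_cst_itv e ab).
apply: le_Rintegral => //; exact: (integrable_norm iB).
Qed.

Lemma Rintegral_itv_split G a b c : continuous G -> a <= b -> b <= c ->
  \int[mu]_(x in `[a, c[) G x =
  \int[mu]_(x in `[a, b[) G x + \int[mu]_(x in `[b, c[) G x.
Proof.
move=> cG ab bc; have U : `[a, c[%classic = `[a, b[ `|` `[b, c[ :> set R.
  by rewrite (@itv_bndbnd_setU _ _ _ (BLeft b)).
rewrite U Rintegral_setU//; first by rewrite -U; exact: integrable_continuous.
rewrite disj_set2E; apply/eqP; rewrite -subset0 => x /=.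
rewrite !in_itv /= => -[/andP[_ h1] /andP[h2 _]].
by rewrite ltNge h2 in h1.
Qed.

Lemma Rintegral_riemann G a (h : R) N (v : 'I_N -> R) e : continuous G -> 0 <= h ->
  (forall (i : 'I_N) x, a + i%:R * h <= x < a + i.+1%:R * h -> `|G x - v i| <= e) ->
  `|\int[mu]_(x in `[a, a + N%:R * h[) G x - \sum_i h * v i| <= e * (N%:R * h).
Proof.
move=> cG h0; elim: N v => [|N IHN] v Gv.
  by rewrite big_ord0 mul0r mulr0 addr0 subr0 set_itvco0 Rintegral_set0 normr0.
rewrite big_ord_recr /= (@Rintegral_itv_split _ _ (a + N%:R * h))//; last 2 first.
- by rewrite lerDl mulr_ge0.
- by rewrite lerD2l ler_wpM2r// ler_nat.
have cell := @Rintegral_cell G (a + N%:R * h) (a + N.+1%:R * h) (v ord_max) e cG.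
have {cell} := cell _ (Gv ord_max).
have -> : a + N.+1%:R * h - (a + N%:R * h) = h by rewrite -natr1; ring.
rewrite lerD2l ler_wpM2r ?ler_nat// => /(_ isT) h2.
have h1 := IHN (fun i => v (widen_ord (leqnSn N) i)) (fun i => Gv (widen_ord (leqnSn N) i)).
rewrite opprD addrACA (le_trans (ler_normD _ _))//.
have -> : e * (N.+1%:R * h) = e * (N%:R * h) + e * h by rewrite -natr1; ring.
exact: lerD.
Qed.

End Integral.

(** * Iterated integrals and their Riemann sums *)

Section IteratedIntegral.
Context {R : realType}.
Notation mu := (@lebesgue_measure R).
Implicit Types (F G : seq R -> R).

Definition closel (d : R) (s s' : seq R) : bool :=
  all2 (fun x y => `|x - y| <= d) s s'.

Definition uclist (k : nat) (F : seq R -> R) : Prop :=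
  forall e, 0 < e -> exists2 d, 0 < d &
    forall s s', size s = k -> closel d s s' -> `|F s - F s'| <= e.

Lemma closel_refl d s : 0 <= d -> closel d s s.
Proof. by move=> d0; elim: s => //= x s ->; rewrite subrr normr0 d0. Qed.

Lemma uclist_cons k F x : uclist k.+1 F -> uclist k (fun s => F (x :: s)).
Proof.
move=> uF e /uF[d d0 Fd]; exists d => // s s' sk ss'.
by apply: Fd => /=; rewrite ?sk// subrr normr0 ltW.
Qed.

Variables (a b : R).
Hypothesis ab : a < b.
Local Notation iter := (iter_integral `[a, b[).

(** The two claims are proved together: comparing integrals requires that the
    inner integral be an integrable function of the outer variable, and its
    continuity is the comparison one dimension lower. *)
Lemma iter_integral_close_continuous k :
  (forall F G e, uclist k F -> uclist k G ->
    (forall s, size s = k -> `|F s - G s| <= e) ->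
    `|iter k F - iter k G| <= e * (b - a) ^+ k) /\
  (forall F, uclist k.+1 F -> continuous (fun x => iter k (fun s => F (x :: s)))).
Proof.
have cont_of_close j : (forall F G e, uclist j F -> uclist j G ->
    (forall s, size s = j -> `|F s - G s| <= e) ->
    `|iter j F - iter j G| <= e * (b - a) ^+ j) ->
  forall F, uclist j.+1 F -> continuous (fun x => iter j (fun s => F (x :: s))).
  move=> close_j F uF; apply: ucont_continuous => e e0.
  have ba0 : 0 < (b - a) ^+ j by rewrite exprn_gt0// subr_gt0.
  have [d d0 Fd] := uF (e / (b - a) ^+ j) (divr_gt0 e0 ba0).
  exists d => // x y xy.
  rewrite -[leRHS](divfK (lt0r_neq0 ba0)).
  apply: close_j; try exact: uclist_cons.
  by move=> s sk; apply: Fd => /=; rewrite ?sk ?xy ?closel_refl ?ltW.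
elim: k => [|k [IHclose IHcont]].
  split; last apply: cont_of_close; move=> F G e uF uG FG /=;
    by rewrite expr0 mulr1; exact: FG.
suff H : forall F G e, uclist k.+1 F -> uclist k.+1 G ->
    (forall s, size s = k.+1 -> `|F s - G s| <= e) ->
    `|iter k.+1 F - iter k.+1 G| <= e * (b - a) ^+ k.+1.
  by split => //; exact: cont_of_close H.
move=> F G e uF uG FG /=.
have cF := IHcont F uF; have cG := IHcont G uG.
have iF := @integrable_continuous _ _ a b cF.
have iG := @integrable_continuous _ _ a b cG.
rewrite -RintegralB//.
have := @Rintegral_cell _ (fun x => iter k (fun s => F (x :: s)) -
   iter k (fun s => G (x :: s))) a b 0 (e * (b - a) ^+ k) _ (ltW ab).
rewrite mulr0 subr0 exprSr mulrA; apply.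
  by move=> x; apply: cvgB; [exact: cF|exact: cG].
move=> x _; rewrite subr0; apply: IHclose; try exact: uclist_cons.
by move=> s sk; apply: FG; rewrite /= sk.
Qed.

Lemma iter_integral_continuous k F : uclist k.+1 F ->
  continuous (fun x => iter k (fun s => F (x :: s))).
Proof. exact: (iter_integral_close_continuous k).2. Qed.

Fixpoint iter_sum N (h : R) (y : 'I_N -> R) (k : nat) (F : seq R -> R) : R :=
  if k is k'.+1 then
    \sum_i h * iter_sum h y k' (fun s => F (y i :: s))
  else F [::].

Lemma iter_sum_tuple N h (y : 'I_N -> R) k F :
  iter_sum h y k F = h ^+ k * \sum_(s : k.-tuple 'I_N) F [seq y i | i <- s].
Proof.
elim: k F => [|k IH] F /=.
  rewrite expr0 mul1r (big_pred1 [tuple]) //= => s.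
  by apply/esym/eqP; rewrite tuple0 [RHS]tuple0.
under eq_bigr do rewrite IH mulrA -exprS.
rewrite -big_distrr; congr (_ * _) => /=.
rewrite pair_big /=; symmetry.
rewrite (reindex (fun p : 'I_N * k.-tuple 'I_N => [tuple of p.1 :: p.2])) //=.
exists (fun s : k.+1.-tuple 'I_N => (thead s, [tuple of behead s])).
  by move=> [i s] _; congr pair; apply: val_inj.
by move=> s _; rewrite [RHS]tuple_eta.
Qed.

(** In the induction the inner integrand at a point is compared with the inner
    integrand at a node, whence two functions [F] and [G]. *)
Lemma iter_sum_riemann N h (y : 'I_N -> R) d k F G e :
  0 <= h -> a + N%:R * h = b ->
  (forall (i : 'I_N) x, a + i%:R * h <= x < a + i.+1%:R * h -> `|x - y i| <= d) ->
  uclist k F ->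
  (forall s s', size s = k -> closel d s s' -> `|F s - G s'| <= e) ->
  `|iter k F - iter_sum h y k G| <= e * (b - a) ^+ k.
Proof.
move=> h0 eb yd; have eba : b - a = N%:R * h by rewrite -eb addrC addKr.
elim: k F G => [|k IH] F G uF FG /=.
  by rewrite expr0 mulr1; exact: FG.
have := @Rintegral_riemann _ _ a h N (fun i => iter_sum h y k (fun s => G (y i :: s)))
  (e * (b - a) ^+ k) (iter_integral_continuous uF) h0.
rewrite eb -eba exprSr mulrA; apply => i x ix.
apply: IH; first exact: uclist_cons.
by move=> s s' sk ss'; apply: FG => /=; rewrite ?sk// ss' yd.
Qed.
End IteratedIntegral.

(** * Convergence of determinants to Fredholm's series *)

Section Tannery.
Context {R : realType}.

Lemma cvg_sum_nat (c : nat -> nat -> R) (c' : nat -> R) m :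
  (forall k, c ^~ k @ \oo --> c' k) ->
  (fun n => \sum_(0 <= k < m) c n k) @ \oo --> \sum_(0 <= k < m) c' k.
Proof.
move=> cc; elim: m => [|m IH].
  rewrite big_geq//; under eq_fun do rewrite big_geq//.
  exact: cvg_cst.
rewrite big_nat_recr//=; under eq_fun do rewrite big_nat_recr//=.
exact: cvgD.
Qed.

(** Dominated convergence for series. The partial sum stops at [n.+2] because
    the expansion of a determinant of size [n.+1] has that many terms. *)
Lemma tannery (c : nat -> nat -> R) (c' b : nat -> R) :
  cvgn (series b) -> (forall n k, `|c n k| <= b k) ->
  (forall k, c ^~ k @ \oo --> c' k) ->
  (fun n => \sum_(0 <= k < n.+2) c n k) @ \oo --> limn (series c').
Proof.
move=> cb cleb cc.
have b0 k : 0 <= b k by exact: le_trans (normr_ge0 _) (cleb 0%N k).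
have c'leb k : `|c' k| <= b k.
  rewrite -(cvg_lim _ (cvg_norm (cc k)))//.
  apply: limr_le; last by near=> n; exact: cleb.
  by apply/cvg_ex; exists `|c' k|; exact: cvg_norm.
have cc' : cvgn (series c').
  by apply: normed_cvg; apply: series_le_cvg c'leb cb.
have tail e : 0 < e -> exists m, forall p, (m <= p)%N ->
    \sum_(m <= k < p) b k <= e.
  move=> e0; have /cvgrPdist_le/(_ e e0)[m _ bm] := cb; exists m => p mp.
  rewrite -sub_series_geq// (le_trans _ (bm m (leqnn m)))//.
  rewrite (le_trans _ (ler_norm _))// lerD2r.
  by apply: nondecreasing_cvgn_le => //; exact: nondecreasing_series.
have sum_le (d : nat -> R) m p : (forall k, `|d k| <= b k) ->
    `|\sum_(m <= k < p) d k| <= \sum_(m <= k < p) b k.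
  by move=> db; rewrite (le_trans (ler_norm_sum _ _ _))// ler_sum.
apply/cvgrPdist_le => e e0.
have e3 : 0 < e / 3 by rewrite divr_gt0.
have [m mb] := tail _ e3.
have h1 : `|limn (series c') - series c' m| <= e / 3.
  have cl : (fun p => `|series c' p - series c' m|) @ \oo -->
      `|limn (series c') - series c' m|.
    by apply: cvg_norm; apply: cvgB => //; exact: cvg_cst.
  rewrite -(cvg_lim _ cl)//; apply: limr_le; first by apply/cvg_ex; eexists; exact: cl.
  near=> p; have mp : (m <= p)%N by near: p; exists m.
  by rewrite sub_series_geq// (le_trans (sum_le _ _ _ c'leb))// mb.
have /cvgrPdist_le/(_ _ e3) h2 := @cvg_sum_nat c c' m cc.
near=> n.
have mn : (m <= n.+2)%N by near: n; exists m => // n /= mn; do 2!apply: leqW.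
have h2n : `|\sum_(0 <= k < m) c' k - \sum_(0 <= k < m) c n k| <= e / 3.
  by near: n.
have h3 : `|\sum_(m <= k < n.+2) c n k| <= e / 3.
  by rewrite (le_trans (sum_le _ _ _ (cleb n)))// mb.
rewrite (@big_cat_nat _ _ _ m)//= opprD addrA.
have -> : limn (series c') - \sum_(0 <= i < m) c n i =
  (limn (series c') - series c' m) +
  (\sum_(0 <= k < m) c' k - \sum_(0 <= k < m) c n k).
  by rewrite /series /=; ring.
rewrite (le_trans (ler_normB _ _))//.
have := ler_normD (limn (series c') - series c' m)
  (\sum_(0 <= k < m) c' k - \sum_(0 <= k < m) c n k).
lra.
Unshelve. all: by end_near. Qed.

(** Hadamard's inequality bounds the [k]-th term [x] of Fredholm's series by
    [q ^+ k * k ^ (k / 2) / k!]. Summability is made explicit by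
    [x <= (2 ^+ k * x ^+ 2 + 2 ^- k) / 2] and [k ^ k <= e ^ k * k!]. *)
Definition fredholm_majorant (q : R) (k : nat) : R :=
  2^-1 * ((2 * (q ^+ 2 * expR 1)) ^+ k / k`!%:R + (2^-1) ^+ k).

Lemma cvg_fredholm_majorant q : cvgn (series (fredholm_majorant q)).
Proof.
rewrite (_ : fredholm_majorant q =
  2^-1 *: (exp_coeff (2 * (q ^+ 2 * expR 1)) + geometric 1 (2^-1))); last first.
  by apply/funext => k; rewrite /fredholm_majorant /GRing.scale/= /GRing.add/= mul1r.
apply: is_cvg_seriesZ; apply: is_cvg_seriesD.
  exact: is_cvg_series_exp_coeff.
by apply: is_cvg_geometric_series; rewrite gtr0_norm ?invf_lt1// ltr1n.
Qed.

Lemma exprnn_le_expR_fact k : k%:R ^+ k <= expR 1 ^+ k * k`!%:R :> R.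
Proof.
rewrite -expRM_natl mulr1 -ler_pdivrMr ?ltr0n ?fact_gt0//.
case: k => [|k]; first by rewrite expr0 fact0 divr1 expR0.
apply: le_trans (expR_ge1Dxn k _) => //.
by rewrite lerDr.
Qed.

Lemma le_fredholm_majorant q k x : 0 <= q -> 0 <= x ->
  (x * k`!%:R) ^+ 2 <= (q ^+ 2 * k%:R) ^+ k -> x <= fredholm_majorant q k.
Proof.
move=> q0 x0 hx.
have f0 : 0 < k`!%:R :> R by rewrite ltr0n fact_gt0.
have x2 : x ^+ 2 <= (q ^+ 2 * expR 1) ^+ k / k`!%:R.
  rewrite ler_pdivlMr// -(ler_pM2r f0) -mulrA -expr2 -exprMn.
  rewrite (le_trans hx)// exprMn [in leRHS]exprMn -mulrA ler_wpM2l ?exprn_ge0 ?sqr_ge0//.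
  exact: exprnn_le_expR_fact.
rewrite /fredholm_majorant exprMn.
have p0 : 0 < 2 ^+ k :> R by rewrite exprn_gt0.
rewrite -(ler_pM2l p0) exprVn.
have -> : 2 ^+ k * (2^-1 * (2 ^+ k * (q ^+ 2 * expR 1) ^+ k / k`!%:R + (2 ^+ k)^-1))
  = 2^-1 * (2 ^+ k ^+ 2 * ((q ^+ 2 * expR 1) ^+ k / k`!%:R) + 1).
  by field; rewrite !lt0r_neq0.
have : 2 ^+ k ^+ 2 * x ^+ 2 <= 2 ^+ k ^+ 2 * ((q ^+ 2 * expR 1) ^+ k / k`!%:R).
  by rewrite ler_wpM2l// sqr_ge0.
have := sqr_ge0 (2 ^+ k * x - 1).
rewrite sqrrB1 exprMn -mulr_natl.
lra.
Qed.
End Tannery.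

Section DetPerturbation.
Context {R : realFieldType}.

Lemma prod_close (I : eqType) (r : seq I) (x y : I -> R) M e : 1 <= M ->
  (forall i, `|x i| <= M) -> (forall i, `|y i| <= M) ->
  (forall i, `|x i - y i| <= e) ->
  `|\prod_(i <- r) x i - \prod_(i <- r) y i| <= (size r)%:R * M ^+ size r * e.
Proof.
move=> M1 xM yM xye; have M0 : 0 <= M by lra.
elim: r => [|i r IH]; first by rewrite !big_nil subrr normr0 !mul0r.
have e0 : 0 <= e by exact: le_trans (normr_ge0 _) (xye i).
rewrite !big_cons /=.
have -> : x i * \prod_(j <- r) x j - y i * \prod_(j <- r) y j =
  x i * (\prod_(j <- r) x j - \prod_(j <- r) y j) +
  (x i - y i) * \prod_(j <- r) y j by ring.
rewrite (le_trans (ler_normD _ _))// !normrM.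
have py : `|\prod_(j <- r) y j| <= M ^+ size r.
  elim: (r) => [|j r' IHr]; first by rewrite big_nil normr1.
  by rewrite big_cons normrM exprS; apply: ler_pM.
have h1 : `|x i| * `|\prod_(j <- r) x j - \prod_(j <- r) y j| <=
   M * ((size r)%:R * M ^+ size r * e) by apply: ler_pM.
have h2 : `|x i - y i| * `|\prod_(j <- r) y j| <= e * M ^+ size r.
  by apply: ler_pM.
have h3 : e * M ^+ size r <= e * M ^+ (size r).+1.
  by rewrite ler_wpM2l// exprS ler_peMl// exprn_ge0.
rewrite (le_trans (lerD h1 (le_trans h2 h3)))// -natr1 exprS.
by rewrite le_eqVlt; apply/orP; left; apply/eqP; ring.
Qed.

Lemma det_close n (A B : 'M[R]_n) M e : 1 <= M ->
  (forall i j, `|A i j| <= M) -> (forall i j, `|B i j| <= M) ->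
  (forall i j, `|A i j - B i j| <= e) ->
  `|\det A - \det B| <= n`!%:R * (n%:R * M ^+ n * e).
Proof.
move=> M1 AM BM ABe; rewrite /determinant -sumrB.
rewrite (le_trans (ler_norm_sum _ _ _))//.
rewrite -[X in X%:R * _]perm.card_Sn mulr_natl -sumr_const; apply: ler_sum => s _.
rewrite -mulrBr normrM normrX normrN1 expr1n mul1r.
have := @prod_close _ (index_enum 'I_n) (fun i => A i (perm.fun_of_perm s i)) (fun i => B i (perm.fun_of_perm s i)) M e M1.
have -> : size (index_enum 'I_n) = n.
  by rewrite /index_enum; case: index_enum_key; rewrite -enumT size_enum_ord.
exact.
Qed.

Lemma det_bounded n (A : 'M[R]_n) M : 0 <= M ->
  (forall i j, `|A i j| <= M) -> \det A ^+ 2 <= (M ^+ 2 * n%:R) ^+ n.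
Proof.
move=> M0 AM; apply: (le_trans (hadamard A)).
rewrite -[X in _ ^+ X](card_ord n) -prodr_const; apply: ler_prod => i _.
rewrite sumr_ge0 /=; last by move=> j _; exact: sqr_ge0.
apply: (@le_trans _ _ (\sum_(j < n) M ^+ 2)).
  by apply: ler_sum => j _; rewrite -real_normK ?num_real// lerXn2r// nnegrE.
by rewrite sumr_const card_ord mulr_natr.
Qed.
End DetPerturbation.

Section FredholmGrid.
Context {R : realType}.
Variables (K : R -> R) (M a b : R).
Hypotheses (uK : ucont K) (M1 : 1 <= M) (KM : forall x, `|K x| <= M) (ab : a < b).

Definition kernel_det (s : seq R) : R :=
  \det (\matrix_(i < size s, j < size s) K (s`_i + s`_j)).

Lemma kernel_detE k (s : seq R) : size s = k ->
  kernel_det s = \det (\matrix_(i < k, j < k) K (s`_i + s`_j)).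
Proof. by move=> <-. Qed.

Lemma closel_size (d : R) s s' : closel d s s' -> size s = size s'.
Proof. by elim: s s' => [|x s IH] [|y s'] //= /andP[_ /IH ->]. Qed.

Lemma closel_nth (d : R) s s' i : 0 <= d -> closel d s s' -> `|s`_i - s'`_i| <= d.
Proof.
move=> d0; elim: s s' i => [|x s IH] [|y s'] //= i.
  by rewrite nth_nil subrr normr0.
by case: i => [|i] /andP[xy ss'] //=; exact: IH.
Qed.

Lemma uclist_kernel_det k : uclist k kernel_det.
Proof.
move=> e e0.
(* [k.+1] instead of [k] keeps [c] positive when [k = 0]. *)
pose c : R := k`!%:R * (k.+1%:R * M ^+ k).
have c0 : 0 < c.
  by rewrite !mulr_gt0// ?exprn_gt0 ?ltr0n ?fact_gt0// (lt_le_trans ltr01).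
have [d d0 Kd] := uK (divr_gt0 e0 c0).
exists (d / 2); first by rewrite divr_gt0.
move=> s s' sk ss'.
rewrite (kernel_detE sk) (@kernel_detE k s') -?(closel_size ss')//.
have ec0 : 0 <= e / c by rewrite divr_ge0// ltW.
rewrite (le_trans (@det_close _ _ _ _ M (e / c) M1 _ _ _))//.
- by move=> i j; rewrite mxE.
- by move=> i j; rewrite mxE.
- move=> i j; rewrite !mxE; apply: Kd.
  have d20 : 0 <= d / 2 by rewrite divr_ge0// ltW.
  rewrite opprD addrACA (le_trans (ler_normD _ _))//.
  have := closel_nth i d20 ss'; have := closel_nth j d20 ss'; lra.
rewrite mulrA -[leRHS](divfK (lt0r_neq0 c0)) [leRHS]mulrC ler_wpM2r//.
by rewrite ler_wpM2l// ler_wpM2r ?ler_nat// exprn_ge0// (le_trans ler01).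
Qed.

Lemma kernel_det_bounded k s : size s = k ->
  kernel_det s ^+ 2 <= (M ^+ 2 * k%:R) ^+ k.
Proof.
move=> sk; rewrite (kernel_detE sk); apply: det_bounded => [|i j]; last by rewrite mxE.
exact: le_trans ler01 M1.
Qed.

Variable lam : R.
Hypothesis lam1 : `|lam| <= 1.

Lemma det_grid_series N h (y : 'I_N -> R) :
  \det (1%:M + \matrix_(i, j) (lam * (h * K (y i + y j)))) =
  \sum_(0 <= k < N.+1) lam ^+ k / k`!%:R * iter_sum h y k kernel_det.
Proof.
rewrite det_1_add_tuples big_mkord; apply: eq_bigr => k _.
rewrite iter_sum_tuple -mulrA mulrCA; congr (_ * _).
rewrite mulrA -exprMn big_distrr /=; apply: eq_bigr => s _.
rewrite (@kernel_detE k) ?size_map ?size_tuple// -detZ; congr (\det _).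
apply/matrixP => i j; rewrite !mxE mulrA.
by rewrite !(nth_map (tnth s i)) ?size_tuple// -!tnth_nth.
Qed.

Lemma iter_sum_bounded N h (y : 'I_N -> R) k : 0 <= h ->
  `|lam ^+ k / k`!%:R * iter_sum h y k kernel_det| <=
  fredholm_majorant (N%:R * h * M) k.
Proof.
move=> h0; have M0 : 0 <= M := le_trans ler01 M1.
apply: le_fredholm_majorant => //; first by rewrite !mulr_ge0.
have f0 : 0 < k`!%:R :> R by rewrite ltr0n fact_gt0.
have -> : `|lam ^+ k / k`!%:R * iter_sum h y k kernel_det| * k`!%:R =
    `|lam| ^+ k * `|iter_sum h y k kernel_det|.
  by rewrite !normrM normfV normrX (gtr0_norm f0) mulrAC divfK ?lt0r_neq0.
rewrite exprMn.
have lk : (`|lam| ^+ k) ^+ 2 <= 1 by rewrite -exprM exprn_ile1.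
rewrite (le_trans (ler_wpM2r _ lk)) ?sqr_ge0// mul1r real_normK ?num_real//.
pose B := Num.sqrt ((M ^+ 2 * k%:R) ^+ k).
have MB : 0 <= (M ^+ 2 * k%:R) ^+ k by rewrite exprn_ge0// mulr_ge0// sqr_ge0.
have sB (s : k.-tuple 'I_N) : `|kernel_det [seq y i | i <- s]| <= B.
  rewrite -sqrtr_sqr ler_wsqrtr//; apply: kernel_det_bounded.
  by rewrite size_map size_tuple.
rewrite iter_sum_tuple exprMn.
have hS : `|\sum_(s : k.-tuple 'I_N) kernel_det [seq y i | i <- s]| <= N%:R ^+ k * B.
  rewrite (le_trans (ler_norm_sum _ _ _))//.
  apply: (@le_trans _ _ (\sum_(s : k.-tuple 'I_N) B)); first exact: ler_sum.
  by rewrite sumr_const card_tuple card_ord -[leLHS]mulr_natl natrX.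
rewrite -[X in _ * X <= _]real_normK ?num_real//.
have hS2 : `|\sum_(s : k.-tuple 'I_N) kernel_det [seq y i | i <- s]| ^+ 2 <= (N%:R ^+ k * B) ^+ 2.
  by rewrite lerXn2r// nnegrE mulr_ge0// ?exprn_ge0// sqrtr_ge0.
rewrite (le_trans (ler_wpM2l (sqr_ge0 _) hS2))//.
rewrite exprMn sqr_sqrtr// mulrA -!exprM ![(k * 2)%N]mulnC !exprM -!exprMn.
by rewrite le_eqVlt; apply/orP; left; apply/eqP; congr (_ ^+ _); ring.
Qed.

Definition mesh (n : nat) : R := (b - a) / n.+1%:R.
(** [theta] locates the node in its cell: with [theta = 1] the last node is [b],
    and [theta = 2^-1] gives midpoints. *)
Definition node (theta : R) (n : nat) (i : 'I_n.+1) : R := a + (i%:R + theta) * mesh n.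

Lemma mesh_gt0 n : 0 < mesh n.
Proof. by rewrite divr_gt0// subr_gt0. Qed.

Lemma mesh_mul n : n.+1%:R * mesh n = b - a.
Proof. by rewrite mulrC divfK// pnatr_eq0. Qed.

Lemma mesh_cvg0 : mesh @ \oo --> 0.
Proof.
rewrite -(mulr0 (b - a)); apply: cvgM; first exact: cvg_cst.
exact: cvg_harmonic.
Qed.

Lemma node_close theta n (i : 'I_n.+1) x : 0 <= theta <= 1 ->
  a + i%:R * mesh n <= x < a + i.+1%:R * mesh n -> `|x - node theta i| <= mesh n.
Proof.
move=> /andP[t0 t1] /andP[x1 x2]; have h0 := mesh_gt0 n.
rewrite /node; move: x2; rewrite -natr1 => x2.
have : theta * mesh n <= mesh n by rewrite ler_piMl// ltW.
have : 0 <= theta * mesh n by rewrite mulr_ge0// ltW.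
rewrite ler_norml; rewrite !mulrDl in x2 *; lra.
Qed.

(** Each term of the expansion is a Riemann sum of the corresponding term of
    Fredholm's series, uniformly dominated by [fredholm_majorant]. *)
Lemma det_grid_cvg theta : 0 <= theta <= 1 ->
  (fun n => \det (1%:M + \matrix_(i, j)
     (lam * (mesh n * K (node theta (n := n) i + node theta j))))) @ \oo -->
  fredholm_det `[a, b[ (fun x y => K (x + y)) lam.
Proof.
move=> th; under eq_fun do rewrite det_grid_series.
apply: (@tannery _ (fun n k => lam ^+ k / k`!%:R *
    iter_sum (mesh n) (node theta (n := n)) k kernel_det) _
    (fredholm_majorant ((b - a) * M))).
- exact: cvg_fredholm_majorant.
- by move=> n k; rewrite -(mesh_mul n); apply: iter_sum_bounded; exact: ltW (mesh_gt0 n).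
move=> k; apply: cvgM; first exact: cvg_cst.
apply/cvgrPdist_le => e e0.
have c0 : 0 < (b - a) ^+ k by rewrite exprn_gt0// subr_gt0.
have [d d0 Kd] := uclist_kernel_det k (divr_gt0 e0 c0).
have /cvgrPdist_le/(_ d d0) md := mesh_cvg0.
near=> n.
have hd : mesh n <= d.
  have : `|0 - mesh n| <= d by near: n; exact: md.
  by rewrite sub0r normrN gtr0_norm ?mesh_gt0.
rewrite -[leRHS](divfK (lt0r_neq0 c0)).
apply: (@iter_sum_riemann _ a b ab _ _ _ d) => //.
- exact: ltW (mesh_gt0 n).
- by rewrite mesh_mul addrC subrK.
- by move=> i x xi; rewrite (le_trans _ hd)// node_close.
- exact: uclist_kernel_det.
Unshelve. all: by end_near. Qed.
End FredholmGrid.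

(** * Limits of solutions of the discretised equations *)

Section LimitTools.
Context {R : realType}.

(** A cluster point of [u] along [U] is a limit, since [U] contains each set or
    its complement. *)
Lemma ultra_bounded_cvg (U : set_system nat) (u : nat -> R) B :
  UltraFilter U -> (forall m, `|u m| <= B) ->
  exists l : R, u m @[m --> U] --> l.
Proof.
move=> UU uB; have PU : ProperFilter U by exact: ultra_proper.
have UB : U (u @^-1` `[-B, B]%classic).
  by apply: filterE => m; rewrite /= in_itv /= -ler_norml.
have [l [_ ul]] := @segment_compact R (-B) B (u @ U) _ UB.
exists l; apply/cvgrPdist_lt => e e0.
have [//|nU] := in_ultra_setVsetC [set m | `|l - u m| < e] UU.
have [|x [ux /= xl]] := ul (~` ball l e) (ball l e) _ (nbhsx_ballx l e e0).
  by apply: filterS nU => m /= h; exact: h.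
by case: ux.
Qed.

Lemma riemann_cvg (f : R -> R) (a b : R) : a < b -> ucont f ->
  forall e, 0 < e -> exists n0, forall n, (n0 <= n)%N ->
  `|\int[lebesgue_measure]_(x in `[a, b[) f x -
    \sum_i mesh a b n * f (node a b 1 (n := n) i)| <= e.
Proof.
move=> ab uf e e0; have ba : 0 < b - a by rewrite subr_gt0.
have [d d0 fd] := uf _ (divr_gt0 e0 ba).
have /cvgrPdist_le/(_ d d0)[n0 _ md] := mesh_cvg0 a b.
exists n0 => n n0n.
have hd : mesh a b n <= d.
  by have := md n n0n; rewrite sub0r normrN gtr0_norm ?mesh_gt0.
rewrite -[leRHS](divfK (lt0r_neq0 ba)); set e' := e / (b - a) in fd *.
rewrite -(mesh_mul _ _ n).
have {1}-> : b = a + n.+1%:R * mesh a b n by rewrite mesh_mul addrC subrK.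
apply: Rintegral_riemann; first exact: ucont_continuous.
  exact: ltW (mesh_gt0 ab n).
move=> i x xi; apply: fd; rewrite (le_trans _ hd)//.
by apply: node_close => //; rewrite ler01 lexx.
Qed.
End LimitTools.

Section Nystrom.
Context {R : realType}.
Variables (K : R -> R) (M a b lam : R).
Hypotheses (uK : ucont K) (M1 : 1 <= M) (KM : forall x, `|K x| <= M) (ab : a < b).

Local Notation nd n := (node a b 1 (n := n)).
Local Notation h := (mesh a b).

(** Nystroem's interpolant: the integral operator applied to a function known
    at the nodes only. *)
Definition nystrom (n : nat) (v : 'I_n.+1 -> R) (x : R) : R :=
  \sum_j h n * (K (x + nd n j) * v j).

Lemma sum_mesh n (c : R) : \sum_(i < n.+1) h n * c = (b - a) * c.
Proof. by rewrite sumr_const card_ord -mulr_natl mulrA mesh_mul. Qed.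

Lemma sum_mesh_le n (c : R) (w : 'I_n.+1 -> R) :
  (forall i, `|w i| <= c) -> `|\sum_i h n * w i| <= (b - a) * c.
Proof.
move=> wc; rewrite -(sum_mesh n) (le_trans (ler_norm_sum _ _ _))//.
apply: ler_sum => i _; rewrite normrM gtr0_norm ?mesh_gt0//.
by rewrite ler_wpM2l// ltW// mesh_gt0.
Qed.

Lemma node_right_itv n (i : 'I_n.+1) : a <= nd n i <= b.
Proof.
have h0 := mesh_gt0 ab n.
rewrite lerDl mulr_ge0 ?addr_ge0// ?(ltW h0)//= -lerBrDl -(mesh_mul a b n).
by rewrite ler_wpM2r ?(ltW h0)// natr1 ler_nat.
Qed.

Variables (nn : nat -> nat) (v : forall m, 'I_(nn m).+1 -> R) (V beta : R).
Hypothesis nn_ge : forall m, (m <= nn m)%N.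
Hypothesis vV : forall m i, `|@v m i| <= V.
Hypothesis v_residual : forall e, 0 < e -> exists m0, forall m, (m0 <= m)%N ->
  forall i, `|@v m i + lam * nystrom (@v m) (nd (nn m) i) - beta| <= e.

(** The interpolants of the [v m] are bounded and equicontinuous because the
    [v m] are bounded, and [v_residual] recovers [v m] from its interpolant.
    Along an ultrafilter the interpolants converge at every point, hence
    uniformly; an ultrafilter limit only provides good approximations for
    arbitrarily large [m], which is all that is needed. *)
Lemma nystrom_limit : exists phi, [/\ ucont phi,
  forall x, phi x + lam * \int[lebesgue_measure]_(y in `[a, b[) (K (x + y) * phi y) = beta &
  forall e m0, 0 < e -> exists2 m, (m0 <= m)%N &
    forall i, `|@v m i - phi (nd (nn m) i)| <= e].
Proof.
have ba : 0 < b - a by rewrite subr_gt0.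
have M0 : 0 <= M := le_trans ler01 M1.
have V0 : 0 <= V := le_trans (normr_ge0 _) (vV (ord0 : 'I_(nn 0).+1)).
pose g m := nystrom (@v m).
have gB m x : `|g m x| <= (b - a) * (M * V).
  by apply: sum_mesh_le => i; rewrite normrM ler_pM.
have guc e : 0 < e -> exists2 d, 0 < d &
    forall m x y, `|x - y| <= d -> `|g m x - g m y| <= e.
  move=> e0; have c0 : 0 < (b - a) * (V + 1) by rewrite mulr_gt0// ltr_wpDl.
  have [d d0 Kd] := uK (divr_gt0 e0 c0); exists d => // m x y xy.
  rewrite -sumrB; under eq_bigr do rewrite -mulrBr -mulrBl.
  rewrite (le_trans (@sum_mesh_le _ (e / ((b - a) * (V + 1)) * (V + 1)) _ _))//.
    move=> i; rewrite normrM ler_pM//.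
      by apply: Kd; rewrite opprD addrACA subrr addr0.
    by rewrite (le_trans (vV i))// lerDl.
  by rewrite mulrCA divfK// lt0r_neq0.
have [U [UU oU]] := ultraFilterLemma eventually_filter.
have PU : ProperFilter U by exact: ultra_proper.
have /choice[G gG] x : exists l : R, g m x @[m --> U] --> l.
  exact: ultra_bounded_cvg (gB ^~ x).
have gGle x e : 0 < e -> U [set m | `|G x - g m x| <= e].
  by move=> e0; have /cvgrPdist_le/(_ e e0) := gG x.
have Uex (A : set nat) : U A -> exists m, A m by move=> /filter_ex.
have Ule m0 : U [set m | (m0 <= m)%N] by apply: oU; exists m0.
have GB x : `|G x| <= (b - a) * (M * V).
  apply/ler_addgt0Pr => e e0; have [m /= mG] := Uex _ (gGle x e e0).
  by rewrite -(subrK (g m x) (G x)) (le_trans (ler_normD _ _))// addrC lerD.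
have uG : ucont G.
  move=> e e0; have [d d0 gd] := guc e e0; exists d => // x y xy.
  apply/ler_addgt0Pr => e' e'0; have e'2 : 0 < e' / 2 by rewrite divr_gt0.
  have [m /= [m1 m2]] := Uex _ (filterI (gGle x _ e'2) (gGle y _ e'2)).
  have := gd m x y xy; rewrite !ler_norml in m1 m2 *; lra.
have gunif e : 0 < e -> U [set m | forall x, a <= x <= b -> `|G x - g m x| <= e].
  move=> e0; have e3 : 0 < e / 3 by rewrite divr_gt0.
  have [d1 d10 gd] := guc _ e3; have [d2 d20 Gd] := uG _ e3.
  pose d := Num.min d1 d2; have d0 : 0 < d by rewrite lt_min d10.
  (* Uniformity is propagated by steps of length [d] from the left end. *)
  have step J : U [set m | forall x, a <= x <= a + J%:R * d -> `|G x - g m x| <= e].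
    elim: J => [|J IH].
      apply: filterS (gGle a e e0) => m /= am x.
      by rewrite mul0r addr0 -eq_le => /eqP <-.
    apply: filterS (filterI IH (gGle (a + J%:R * d) _ e3)) => m /= [m1 m2] x.
    rewrite -natr1 mulrDl mul1r addrA => /andP[ax xd].
    have [xJ|Jx] := leP x (a + J%:R * d); first by apply: m1; rewrite ax.
    have xJd : `|x - (a + J%:R * d)| <= d by rewrite gtr0_norm ?subr_gt0// lerBlDl.
    have dd1 : d <= d1 by rewrite /d ge_min lexx.
    have dd2 : d <= d2 by rewrite /d ge_min lexx orbT.
    have h1 := gd m _ _ (le_trans xJd dd1); have h2 := Gd _ _ (le_trans xJd dd2).
    rewrite !ler_norml in h1 h2 m2 *; lra.
  have Jd := archi_boundP (divr_ge0 (ltW ba) (ltW d0)).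
  apply: filterS (step (Num.Def.archi_bound ((b - a) / d))) => m /= mJ x /andP[ax xb].
  apply: mJ; rewrite ax (le_trans xb)// -lerBlDl -ler_pdivrMr//.
  exact: ltW.
pose phi x := beta - lam * G x.
have lam1 : 0 < `|lam| + 1 by rewrite ltr_wpDl.
have lam_le x y e : `|x - y| <= e / (`|lam| + 1) -> `|lam * x - lam * y| <= e.
  move=> xye; rewrite -mulrBr normrM.
  have e0 : 0 <= e / (`|lam| + 1) := le_trans (normr_ge0 _) xye.
  rewrite (le_trans (ler_wpM2l _ xye))// -[leRHS](divfK (lt0r_neq0 lam1)) mulrC.
  by rewrite ler_wpM2l// lerDl.
have uphi : ucont phi.
  move=> e e0; have [d d0 Gd] := uG _ (divr_gt0 e0 lam1); exists d => // x y xy.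
  have := lam_le _ _ _ (Gd _ _ xy); rewrite /phi !ler_norml; lra.
have phiB x : `|phi x| <= `|beta| + `|lam| * ((b - a) * (M * V)).
  by rewrite (le_trans (ler_normB _ _))// lerD2l normrM ler_wpM2l.
have approx e : 0 < e ->
    U [set m | forall i, `|@v m i - phi (nd (nn m) i)| <= e].
  move=> e0; have e2 : 0 < e / 2 by rewrite divr_gt0.
  have [m0 vm] := v_residual e2.
  apply: filterS (filterI (Ule m0) (gunif _ (divr_gt0 e2 lam1))) => m /= [m0m mG] i.
  have := lam_le _ _ _ (mG _ (node_right_itv i)); have := vm m m0m i.
  by rewrite /phi -/(g m _) !ler_norml; lra.
exists phi; split => //; last first.
  move=> e m0 e0; have [m /= [m0m mv]] := Uex _ (filterI (Ule m0) (approx e e0)).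
  by exists m.
move=> x; suff <- : G x = \int[lebesgue_measure]_(y in `[a, b[) (K (x + y) * phi y).
  by rewrite /phi subrK.
apply/eqP; rewrite -subr_eq0 -normr_le0; apply/ler_addgt0Pr => e e0; rewrite add0r.
have uKphi := ucontM (ucont_shift x uK) uphi (fun y => KM (x + y)) phiB.
have e3 : 0 < e / 3 by rewrite divr_gt0.
have [n0 rie] := riemann_cvg ab uKphi e3.
have c0 : 0 < (b - a) * M by rewrite mulr_gt0// (lt_le_trans ltr01).
have [m /= [n0m [mG mv]]] := Uex _ (filterI (Ule n0) (filterI (gGle x _ e3)
  (approx _ (divr_gt0 e3 c0)))).
have h1 := rie (nn m) (leq_trans n0m (nn_ge m)).
have h2 : `|g m x - \sum_i h (nn m) * (K (x + nd (nn m) i) * phi (nd (nn m) i))| <= e / 3.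
  rewrite -sumrB; under eq_bigr do rewrite -!mulrBr.
  rewrite (le_trans (@sum_mesh_le _ (M * (e / 3 / ((b - a) * M))) _ _))//.
    by move=> i; rewrite normrM ler_pM.
  by rewrite mulrA mulrC divfK// lt0r_neq0.
rewrite !ler_norml in h1 h2 mG *; lra.
Qed.
End Nystrom.

(** * Stability, solvability and nonvanishing determinants *)

Section Stability.
Context {R : realType}.
Variables (K : R -> R) (M a b lam : R).
Hypotheses (uK : ucont K) (M1 : 1 <= M) (KM : forall x, `|K x| <= M) (ab : a < b).
Hypothesis lam1 : `|lam| = 1.
Local Notation nd n := (node a b 1 (n := n)).
Local Notation h := (mesh a b).

Definition integral_eq (phi : R -> R) (beta : R) : Prop :=
  forall x, phi x + lam * \int[lebesgue_measure]_(y in `[a, b[) (K (x + y) * phi y) = beta.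

Hypothesis inj : forall phi, ucont phi -> integral_eq phi 0 -> forall x, phi x = 0.

Definition grid_mx (n : nat) : 'M[R]_n.+1 :=
  \matrix_(i, j) (lam * (h n * K (nd n i + nd n j))).

Lemma grid_mxE n (v : 'cV[R]_n.+1) i :
  ((1%:M + grid_mx n) *m v) i 0 = v i 0 + lam * nystrom K a b (v ^~ 0) (nd n i).
Proof.
rewrite mulmxDl mul1mx mxE; congr (_ + _); rewrite mxE big_distrr /=.
by apply: eq_bigr => j _; rewrite mxE !mulrA.
Qed.

(** Otherwise there are vectors of maximum norm 1 on ever finer grids whose
    images tend to zero; by [nystrom_limit] they approximate a solution of the
    homogeneous equation, which is zero, contradicting their norm. *)
Lemma grid_stable : exists C n0, 0 <= C /\ forall n, (n0 <= n)%N ->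
  forall (v : 'cV[R]_n.+1) beta,
  (forall i, `|((1%:M + grid_mx n) *m v) i 0| <= beta) ->
  forall i, `|v i 0| <= C * beta.
Proof.
apply: contrapT => H.
have /choice[f fP] (m : nat) : exists p : {n : nat & 'I_n.+1 -> R},
    [/\ (m <= projT1 p)%N, forall i, `|projT2 p i| <= 1,
       exists i, `|projT2 p i| = 1 &
       forall i, `|projT2 p i + lam * nystrom K a b (projT2 p) (nd _ i) - 0| <= m.+1%:R^-1].
  apply: contrapT => H'; apply: H; exists m.+1%:R, m; split => // n mn v beta Av i0.
  rewrite leNgt; apply/negP => vi0; apply: H'.
  have beta0 : 0 <= beta := le_trans (normr_ge0 _) (Av i0).
  pose i1 := [arg max_(i > i0) `|v i 0|]%O.
  have vmax i : `|v i 0| <= `|v i1 0|.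
    by rewrite /i1; case: arg_maxP => // j _; exact.
  have W0 : m.+1%:R * beta < `|v i1 0| := lt_le_trans vi0 (vmax i0).
  have W1 : 0 < `|v i1 0| by apply: le_lt_trans W0; rewrite mulr_ge0.
  pose w := (`|v i1 0|^-1) *: v.
  exists (existT _ n (w ^~ 0)); split => //=.
  - by move=> i; rewrite mxE normrM normfV normr_id mulrC ler_pdivrMr// mul1r.
  - by exists i1; rewrite mxE normrM normfV normr_id mulVf// lt0r_neq0.
  - move=> i; rewrite subr0 -grid_mxE -scalemxAr mxE normrM normfV normr_id.
    rewrite mulrC ler_pdivrMr// (le_trans (Av i))// mulrC ler_pdivlMr//.
    by rewrite mulrC ltW.
pose v m := projT2 (f m).
have [] := @nystrom_limit _ K M a b lam uK M1 KM ab (fun m => projT1 (f m)) v 1 0.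
- by move=> m; have [] := fP m.
- by move=> m i; have [_ + _ _] := fP m; apply.
- move=> e e0; have /cvgrPdist_le/(_ e e0)[m0 _ hm] := @cvg_harmonic R.
  exists m0 => m m0m i; have [_ _ _ /(_ i) fm] := fP m.
  have := hm m m0m; rewrite sub0r normrN gtr0_norm ?harmonic_gt0// => hme.
  by apply: le_trans hme; exact: fm.
move=> phi [uphi phieq phiv].
have [m _ mv] := phiv (2^-1) 0%N ltac:(by rewrite invr_gt0).
have [_ _ [i vi1] _] := fP m.
have := mv i; rewrite (inj uphi phieq) subr0 vi1 => h1.
by have : 2^-1 < 1 :> R by [rewrite invf_lt1 ?ltr1n|]; rewrite ltNge h1.
Qed.

(** The solutions on the grids are bounded by stability, so that [nystrom_limit]
    applies to them; the last node is [b]. *)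
Lemma grid_solvable : exists phi, [/\ ucont phi, integral_eq phi 1 &
  forall e n0, 0 < e -> exists2 n, (n0 <= n)%N &
    exists2 w : 'cV[R]_n.+1, (1%:M + grid_mx n) *m w = const_mx 1 &
      `|w ord_max 0 - phi b| <= e].
Proof.
have [C [n0 [C0 stab]]] := grid_stable.
pose nn m := maxn n0 m.
pose w m : 'cV[R]_(nn m).+1 := invmx (1%:M + grid_mx (nn m)) *m const_mx 1.
have Aw m : (1%:M + grid_mx (nn m)) *m w m = const_mx 1.
  rewrite mulKVmx//; apply: (@bounded_below_unitmx _ _ _ C).
  by move=> v beta; apply: stab; rewrite leq_maxl.
have [] := @nystrom_limit _ K M a b lam uK M1 KM ab nn (fun m => (w m) ^~ 0) (C * 1) 1.
- by move=> m; rewrite leq_maxr.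
- move=> m i; apply: stab => [|j]; first by rewrite leq_maxl.
  by rewrite Aw mxE normr1.
- by move=> e e0; exists 0%N => m _ i; rewrite -grid_mxE Aw mxE subrr normr0 ltW.
move=> phi [uphi phieq phiw]; exists phi; split => // e m0 e0.
have [m m0m wphi] := phiw e m0 e0.
exists (nn m); first by rewrite (leq_trans m0m)// leq_maxr.
exists (w m) => //; have := wphi ord_max.
by rewrite /node /= natr1 mesh_mul [a + _]addrC subrK.
Qed.

(** The entries of the grid matrices are at most [h n * M], so that the power in
    [det_bounded_below] stays below a constant, the exponential of
    [(b - a) * c], and the determinants stay away from zero. *)
Lemma fredholm_det_neq0 : fredholm_det `[a, b[ (fun x y => K (x + y)) lam != 0.
Proof.
have [C [n0 [C0 stab]]] := grid_stable.
have ba : 0 < b - a by rewrite subr_gt0.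
have M0 : 0 <= M := le_trans ler01 M1.
set d := fredholm_det _ _ _.
have dcvg : (fun n => \det (1%:M + grid_mx n)) @ \oo --> d.
  by apply: (det_grid_cvg uK M1 KM ab) => //; rewrite ?lam1// ler01 lexx.
pose c := 2 * (C * M) + (b - a) * (C * M) ^+ 2.
have lower n : (n0 <= n)%N -> expR (- ((b - a) * c)) <= \det (1%:M + grid_mx n) ^+ 2.
  move=> n0n; have h0 := mesh_gt0 ab n.
  have := @det_bounded_below _ _ (grid_mx n) (h n * M) C _ (stab n n0n) C0.
  have -> : 1 + 2 * (C * (h n * M)) + n.+1%:R * (C * (h n * M)) ^+ 2 = 1 + h n * c.
    by rewrite /c -(mesh_mul a b n); ring.
  move=> /(_ _)/le_trans H; rewrite expRN -[leLHS]mul1r ler_pdivrMr ?expR_gt0//.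
  apply: H.
    move=> i j; rewrite mxE normrM lam1 mul1r normrM [`|h n|]gtr0_norm//.
    by rewrite ler_wpM2l// ltW.
  rewrite ler_wpM2l ?sqr_ge0// -(mesh_mul a b n) -mulrA expRM_natl.
  rewrite lerXn2r ?nnegrE ?expR_ge0 ?expR_ge1Dx//.
  by rewrite addr_ge0// mulr_ge0 ?(ltW h0)// /c addr_ge0// !mulr_ge0// ?sqr_ge0// ltW.
have : expR (- ((b - a) * c)) <= d ^+ 2.
  have d2 : (fun n => \det (1%:M + grid_mx n) ^+ 2) @ \oo --> d ^+ 2.
    by rewrite expr2; under eq_fun do rewrite expr2; exact: cvgM.
  rewrite -(cvg_lim _ d2)//; apply: limr_ge; first by apply/cvg_ex; eexists; exact: d2.
  by near=> n; apply: lower; near: n; exists n0.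
apply: contraTneq => ->; rewrite expr0n /= -ltNge; exact: expR_gt0.
Unshelve. all: by end_near. Qed.

End Stability.

Section HankelLimit.
Context {R : realType}.
Variables (K : R -> R) (M t lam : R).
Hypotheses (uK : ucont K) (M1 : 1 <= M) (KM : forall x, `|K x| <= M) (t0 : 0 < t).
Hypothesis K0 : forall x, x <= 0 -> K x = 0.
Hypothesis lam1 : `|lam| = 1.
Hypothesis inj : forall phi, ucont phi -> integral_eq K (- t) t lam phi 0 ->
  forall x, phi x = 0.

(** The sum of the nodes of indices [i] and [j] is [(i + j + 1 - n) * h] for right
    endpoints and [(i + j - n) * h] for midpoints, so that the matrix of size
    [n] in [hankel_cramer] is the midpoint matrix without its trivial first row
    and column. *)
Lemma grid_mx_hankel n (w : 'cV[R]_n.+1) :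
  (1%:M + grid_mx K (- t) t lam n) *m w = const_mx 1 ->
  \det (1%:M + grid_mx K (- t) t lam n) * w ord_max 0 =
  \det (1%:M + \matrix_(i, j) (- lam * (mesh (-t) t n *
      K (node (-t) t (2^-1) (n := n) i + node (-t) t (2^-1) j)))).
Proof.
have h0 : 0 < mesh (-t) t n by apply: mesh_gt0; move: t0; lra.
have th : 2 * t = n.+1%:R * mesh (-t) t n by rewrite mesh_mul; ring.
pose mu (m : nat) := - lam * (mesh (-t) t n * K ((m%:R - n%:R) * mesh (-t) t n)).
have mu0 m : (m <= n)%N -> mu m = 0.
  by move=> mn; rewrite /mu K0 ?mulr0// mulr_le0_ge0 ?(ltW h0)// subr_le0 ler_nat.
have -> : grid_mx K (- t) t lam n = \matrix_(i, j < n.+1) - mu (i + j).+1.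
  apply/matrixP => i j; rewrite !mxE /mu mulNr opprK; congr (_ * (_ * K _)).
  apply: (addIr (2 * t)); rewrite {2}th /node -!natr1 natrD; ring.
have -> : \matrix_(i, j) (- lam * (mesh (- t) t n *
      K (node (- t) t 2^-1 (n := n) i + node (- t) t 2^-1 j))) =
    \matrix_(i, j < n.+1) mu (i + j)%N.
  apply/matrixP => i j; rewrite !mxE /mu; congr (_ * (_ * K _)).
  apply: (addIr (2 * t)); rewrite {2}th /node -!natr1 natrD; by field.
rewrite (det_hankel_pad mu0) => /(hankel_cramer (kap := fun m => - mu m.+1)) ->.
  by congr (\det (_ + _)); apply/matrixP => i j; rewrite !mxE opprK.
by move=> i i_n; rewrite mu0// oppr0.
Qed.

Lemma fredholm_det_hankel : exists phi, [/\ ucont phi,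
  integral_eq K (- t) t lam phi 1 &
  fredholm_det `[- t, t[ (fun x y => K (x + y)) lam * phi t =
  fredholm_det `[- t, t[ (fun x y => K (x + y)) (- lam)].
Proof.
have tt : - t < t by move: t0; lra.
have [phi [uphi phieq happrox]] := grid_solvable uK M1 KM tt inj.
exists phi; split => //.
set d := fredholm_det _ _ _; set d' := fredholm_det _ _ _.
have dcvg : (fun n => \det (1%:M + grid_mx K (- t) t lam n)) @ \oo --> d.
  by apply: (det_grid_cvg uK M1 KM tt) => //; rewrite ?lam1// ler01 lexx.
have d'cvg : (fun n => \det (1%:M + \matrix_(i, j) (- lam * (mesh (-t) t n *
      K (node (-t) t (2^-1) (n := n) i + node (-t) t (2^-1) j))))) @ \oo --> d'.
  apply: (det_grid_cvg uK M1 KM tt); first by rewrite normrN lam1.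
  by rewrite invr_ge0 ler0n invf_le1// ler1n.
(* [phi t] is approximated by the discrete solutions on arbitrarily fine grids
   only, but there the determinants are all close to their limits. *)
apply/eqP; rewrite -subr_eq0 -normr_le0; apply/ler_addgt0Pr => e e0; rewrite add0r.
have c0 : 0 < `|d| + `|phi t| + 2 by rewrite ltr_wpDl// addr_ge0.
pose e' := Num.min 1 (e / (`|d| + `|phi t| + 2)).
have e'0 : 0 < e' by rewrite lt_min ltr01 divr_gt0.
have e'1 : e' <= 1 by rewrite /e' ge_min lexx.
have e'e : e' * (`|d| + `|phi t| + 2) <= e by rewrite -ler_pdivlMr// /e' ge_min lexx orbT.
have /cvgrPdist_le/(_ _ e'0)[n1 _ dn] := dcvg.
have /cvgrPdist_le/(_ _ e'0)[n2 _ d'n] := d'cvg.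
have [n n12 [w Aw wphi]] := happrox e' (maxn n1 n2) e'0.
have := dn n (leq_trans (leq_maxl _ _) n12).
have := d'n n (leq_trans (leq_maxr _ _) n12).
rewrite /= -(grid_mx_hankel Aw).
move: (\det _) (w ord_max 0) wphi => D x xphi hd' hd.
have xB : `|x| <= `|phi t| + 1.
  by rewrite -(subrK (phi t) x) (le_trans (ler_normD _ _))// addrC lerD2l (le_trans xphi).
have -> : d * phi t - d' = d * (phi t - x) + (d - D) * x - (d' - D * x) by ring.
rewrite (le_trans (ler_normB _ _))// (le_trans (lerD (ler_normD _ _) (lexx _)))//.
rewrite !normrM (distrC (phi t)).
have h1 : `|d| * `|x - phi t| <= `|d| * e' by rewrite ler_wpM2l.
have h2 : `|d - D| * `|x| <= e' * (`|phi t| + 1) by apply: ler_pM.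
lra.
Qed.
End HankelLimit.

(** * Reduction from the half-line to a bounded interval *)

Section IterRestrict.
Context {R : realType}.
Notation mu := (@lebesgue_measure R).
Implicit Types (F G : seq R -> R).

Lemma Rintegral_eq0 (D : set R) (f : R -> R) :
  (forall x, D x -> f x = 0) -> \int[mu]_(x in D) f x = 0.
Proof.
move=> f0; rewrite (@eq_Rintegral _ _ _ _ _ (cst 0)).
  by rewrite /Rintegral integral0.
by move=> x; rewrite inE; exact: f0.
Qed.

Lemma Rintegral_restrict (a t : R) (f g : R -> R) :
  (forall x, x < a -> x < t -> f x = 0) ->
  (forall x, a <= x < t -> f x = g x) ->
  \int[mu]_(x in `]-oo, t[) f x = \int[mu]_(x in `[a, t[) g x.
Proof.
move=> f0 fg; rewrite Rintegral_mkcond [RHS]Rintegral_mkcond.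
apply: eq_Rintegral => x _; rewrite !patchE !mem_setE !in_itv /=.
have [xt|] := ltP x t; last by rewrite andbF.
by have [ax|xa] := leP a x; [rewrite fg// ax|exact: f0].
Qed.

Lemma iter_integral_eq0 (D : set R) k F :
  (forall s, size s = k -> {in s, forall x, D x} -> F s = 0) ->
  iter_integral D k F = 0.
Proof.
elim: k F => [|k IH] F F0 /=; first exact: F0.
apply: Rintegral_eq0 => x Dx; apply: IH => s sk sD; apply: F0; rewrite /= ?sk//.
by move=> y; rewrite inE => /predU1P[->//|/sD].
Qed.

Lemma iter_integral_restrict (a t : R) k F G :
  (forall s, size s = k -> {in s, forall x, x < t} ->
     (exists2 x, x \in s & x < a) -> F s = 0) ->
  (forall s, size s = k -> {in s, forall x, a <= x < t} -> F s = G s) ->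
  iter_integral `]-oo, t[ k F = iter_integral `[a, t[ k G.
Proof.
elim: k F G => [|k IH] F G F0 FG /=; first exact: FG.
apply: Rintegral_restrict => x.
  move=> xa xt; apply: iter_integral_eq0 => s sk sD; apply: F0; rewrite /= ?sk//.
    move=> y; rewrite inE => /predU1P[->//|/sD].
    by rewrite /= in_itv.
  by exists x; rewrite // mem_head.
move=> /andP[ax xt]; apply: IH => s sk sD.
  move=> [y ys ya]; apply: F0; rewrite /= ?sk//.
    by move=> z; rewrite inE => /predU1P[->//|/sD].
  by exists y; rewrite // inE ys orbT.
apply: FG; rewrite /= ?sk// => z; rewrite inE => /predU1P[->|/sD//].
by rewrite ax.
Qed.

End IterRestrict.

Section Kernel.
Context {R : realType}.
Notation mu := (@lebesgue_measure R).
Variables (K : R -> R).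
Hypotheses (cK : continuous K) (K0 : K3 K).

Lemma kernel_le0 x : x <= 0 -> K x = 0.
Proof.
rewrite le_eqVlt => /predU1P[->|]; last exact: K0.
apply/eqP; rewrite -normr_le0; apply/ler_addgt0Pr => e e0; rewrite add0r.
have [d d0 Kd] := @continuous_ucont_near _ K 0 0 cK e e0.
have := Kd 0 (- d); rewrite lexx (@K0 (- d)) ?oppr_lt0// subr0; apply => //.
by rewrite sub0r opprK gtr0_norm.
Qed.

Lemma fredholm_det_le0 (t lam : R) : t <= 0 ->
  fredholm_det `]-oo, t[ (fun x y => K (x + y)) lam = 1.
Proof.
move=> t0; rewrite /fredholm_det.
set u := (X in series X).
have u0 : u 0%N = 1 by rewrite /u /= det_mx00 expr0 fact0 divr1 mulr1.
have uS k : u k.+1 = 0.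
  rewrite /u iter_integral_eq0 ?mulr0// => s sk sD.
  have -> : \matrix_(i < size s, j < size s) K (s`_i + s`_j) = 0.
    apply/matrixP => i j; rewrite !mxE kernel_le0//.
    have := sD _ (mem_nth 0 (ltn_ord i)); have := sD _ (mem_nth 0 (ltn_ord j)).
    rewrite /= !in_itv /=; lra.
  by move: (size s) sk => ? ->; rewrite det0.
have su n : series u n.+1 = 1.
  by rewrite -[LHS]/(\sum_(0 <= i < n.+1) u i) big_nat_recl// u0 big1 ?addr0.
have cu : series u @ \oo --> (1 : R).
  by rewrite -cvg_shiftS /=; under eq_fun do rewrite su; exact: cvg_cst.
exact: cvg_lim cu.
Qed.

(** This agrees with [K] on all sums [x + y] with [x, y <= t], and is bounded and
    uniformly continuous on the whole line. *)
Definition truncation (t x : R) : R := K (Num.min x (2 * t)).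

Lemma truncationE t x : x <= 2 * t -> truncation t x = K x.
Proof. by move=> xt; rewrite /truncation min_l. Qed.

Lemma truncation_le0 t x : 0 < t -> x <= 0 -> truncation t x = 0.
Proof.
move=> t0 x0; rewrite truncationE ?kernel_le0//.
by rewrite (le_trans x0)// mulr_ge0// ltW.
Qed.

(** If an entry of a list is less than [- t], the corresponding row of the
    kernel matrix vanishes. *)
Lemma fredholm_det_truncation t lam : 0 < t ->
  fredholm_det `]-oo, t[ (fun x y => K (x + y)) lam =
  fredholm_det `[- t, t[ (fun x y => truncation t (x + y)) lam.
Proof.
move=> t0; rewrite /fredholm_det; congr (lim (series _ @ \oo)).
apply/funext => k; congr (_ * _); apply: iter_integral_restrict => s sk sD.
  move=> [x /(nthP 0)[i si <-] sit]; rewrite (expand_det_row _ (Ordinal si)).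
  apply: big1 => j _; rewrite mxE K0 ?mul0r//=.
  have := sD _ (mem_nth 0 (ltn_ord j)); lra.
congr (\det _); apply/matrixP => i j; rewrite !mxE truncationE//.
have := sD _ (mem_nth 0 (ltn_ord i)); have := sD _ (mem_nth 0 (ltn_ord j)); lra.
Qed.

Lemma Rintegral_truncation t x (f : R -> R) : 0 < t -> x <= t ->
  \int[mu]_(y in `]-oo, t[) (K (x + y) * f y) =
  \int[mu]_(y in `[- t, t[) (truncation t (x + y) * f y).
Proof.
move=> t0 xt; apply: Rintegral_restrict => y.
  by move=> yt _; rewrite K0 ?mul0r//; lra.
by move=> /andP[_ yt]; rewrite truncationE//; lra.
Qed.

Lemma integrable_kernel t x (f : R -> R) : continuous f ->
  mu.-integrable `]-oo, t[ (EFin \o (fun y => K (x + y) * f y)).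
Proof.
move=> cf.
have cKf : continuous (fun y => K (x + y) * f y).
  move=> y; apply: cvgM; last exact: cf.
  by apply: (@continuous_comp _ _ _ (fun y => x + y) K); [apply: cvgD; [exact: cvg_cst|exact: cvg_id]|exact: cK].
have := @integrable_continuous R _ (- x) t cKf.
rewrite integrable_mkcond// => I; rewrite integrable_mkcond//.
apply: eq_integrable I => // y _; rewrite !patchE !mem_setE !in_itv /=.
have [yt|] := ltP y t; last by rewrite andbF.
have [//|yx] := leP (- x) y.
by rewrite K0 ?mul0r//; lra.
Qed.

(** The integral only involves values below [t], and the equation then prescribes
    the values at all points. *)
Lemma solution_extension t lam (phi : R -> R) : continuous phi ->
  (forall x, x <= t ->
    phi x + lam * \int[mu]_(y in `]-oo, t[) (K (x + y) * phi y) = 1) ->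
  exists Phi, solution K lam t Phi /\ Phi t = phi t.
Proof.
move=> cphi phieq.
pose Phi x := 1 - lam * \int[mu]_(y in `]-oo, t[) (K (x + y) * phi y).
have PhiE x : x <= t -> Phi x = phi x by move=> xt; rewrite /Phi -(phieq x xt) addrK.
exists Phi; split; last exact: PhiE.
have KPhi x y : y < t -> K (x + y) * Phi y = K (x + y) * phi y.
  by move=> yt; rewrite PhiE// ltW.
move=> x; split.
  apply: eq_integrable (integrable_kernel t x cphi) => // y.
  by rewrite inE /= in_itv /= => yt; rewrite KPhi.
have -> : \int[mu]_(y in `]-oo, t[) (K (x + y) * Phi y) =
    \int[mu]_(y in `]-oo, t[) (K (x + y) * phi y).
  by apply: eq_Rintegral => y; rewrite inE /= in_itv /=; exact: KPhi.
by rewrite subrK.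
Qed.
End Kernel.

(** * Injectivity from the absence of eigenvalues *)

Section EigenvalueFree.
Context {R : realType}.
Notation mu := (@lebesgue_measure R).

Lemma bounded_on (A : set R) (f : R -> R) M :
  (forall x, A x -> `|f x| <= M) -> [bounded f x | x in A].
Proof.
move=> fM; exists M; split; first exact: num_real.
by move=> N MN x /fM /le_trans; apply; exact: ltW.
Qed.

Lemma Lfun2_of_integrable_sqr (f : R -> R) : measurable_fun setT f ->
  mu.-integrable setT (EFin \o (fun x => f x ^+ 2)) -> f \in Lfun mu 2%:E.
Proof.
move=> mf i2; rewrite inE; apply/andP; split; rewrite inE//=.
rewrite /finite_norm unlock poweR_lty//.
have /integrableP[_] := i2; apply: le_lt_trans; apply: ge0_le_integral => //.
- by move=> x _; exact: poweR_ge0.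
- apply/measurable_EFinP.
  apply: (@measurableT_comp _ _ _ _ _ _ (fun x : R => x `^ 2)) => //.
  exact: measurableT_comp.
- by apply: measurableT_comp => //; case/integrableP : i2.
- by move=> x _ /=; rewrite lee_fin powR_mulrn// normrX.
Qed.

(** A nonzero value at [x] persists on an interval with right end [x], which has
    positive measure. *)
Lemma ae_continuous_eq0 (phi : R -> R) t : continuous phi ->
  {ae mu, forall x, x < t -> phi x = 0} -> forall x, x < t -> phi x = 0.
Proof.
move=> cphi ae0 x xt; apply/eqP/negPn/negP => phix.
have p0 : 0 < `|phi x| by rewrite normr_gt0.
have /cvgrPdist_lt/(_ _ p0)[d /= d0 xd] := cphi x.
have : mu.-negligible `]x - d, x[%classic.
  apply: negligibleS ae0 => y /=; rewrite in_itv /= => /andP[y1 y2] h.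
  have := xd y; rewrite h ?(lt_trans y2)// subr0 ltxx => H; suff: false by [].
  apply: H => /=; rewrite gtr0_norm; lra.
move=> /measure_negligible-/(_ (measurable_itv _)) mu0.
have := etrans (esym (lebesgue_measure_itv (`]x - d, x[%O : interval R))) mu0.
rewrite /= lte_fin ltrBlDr ltrDl d0 -EFinB => /eqP.
by rewrite eqe opprB addrCA subrr addr0 gt_eqF.
Qed.

Variables (K : R -> R).
Hypotheses (cK : continuous K) (K0 : K3 K).

(** A solution of the homogeneous equation vanishes below [- t], so it is a
    square integrable eigenfunction for [- lam^-1 = - lam]. *)
Lemma no_eigenvalue_injective t lam phi : 0 < t -> lam * lam = 1 ->
  ~ eigenvalue_opK K t (- lam)%:C ->
  ucont phi -> integral_eq (truncation K t) (- t) t lam phi 0 ->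
  forall x, phi x = 0.
Proof.
move=> t0 lam2 noev uphi phieq.
have cphi := ucont_continuous uphi.
have eqphi x : x <= t -> \int[mu]_(y in `]-oo, t[) (K (x + y) * phi y) = - lam * phi x.
  move=> xt; rewrite (Rintegral_truncation K0)//.
  rewrite -[LHS]mul1r -lam2 -mulrA mulNr -mulrN; congr (_ * _).
  by apply/eqP; rewrite -addr_eq0 addrC; apply/eqP; exact: phieq.
have phi0 x : x < - t -> phi x = 0.
  move=> xt; have := eqphi x ltac:(lra); rewrite Rintegral_eq0.
    move=> /(congr1 (fun z => - lam * z)); rewrite mulr0 mulrA mulrNN lam2 mul1r => <-//.
  by move=> y /=; rewrite in_itv /= => yt; rewrite K0 ?mul0r//; lra.
suff phit0 x : x < t -> phi x = 0.
  move=> x; have := phieq x; rewrite Rintegral_eq0 ?mulr0 ?addr0//.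
  by move=> y /=; rewrite in_itv /= => /andP[_ yt]; rewrite phit0 ?mulr0.
move: x; apply: ae_continuous_eq0 => //.
apply: contrapT => nae; apply: noev; exists (fun x => (phi x)%:C); split.
- have L : (fun x => \1_(`]-oo, t[) x * phi x) \in Lfun mu 2%:E.
    have mphi := continuous_measurable_fun cphi.
    apply: Lfun2_of_integrable_sqr.
      by apply: measurable_funM => //; exact: measurable_indic.
    have cphi2 : continuous (fun x => phi x ^+ 2).
      rewrite (_ : (fun x => phi x ^+ 2) = (fun x => phi x * phi x)).
        by move=> x; apply: cvgM; exact: cphi.
      by apply/funext => x; rewrite expr2.
    have := integrable_continuous (- t) t cphi2.
    rewrite integrable_mkcond// => I; apply: eq_integrable I => // x _.
    rewrite !patchE !mem_setE !in_itv /= indicE mem_setE in_itv /=.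
    have [xt|tx] := leP (- t) x; last by rewrite phi0// mulr0 expr0n.
    by case: (x < t); rewrite ?mul1r ?mul0r ?expr0n.
  split=> //=.
  rewrite (_ : (fun x => \1_(`]-oo, t[) x * 0) = (fun x => cst 0 x)).
    apply: Lfun2_of_integrable_sqr; first exact: measurable_cst.
    apply: eq_integrable (integrable0 _ _) => // x _ /=.
    by rewrite expr0n.
  by apply/funext => x; rewrite mulr0.
- move=> ae0; apply: nae; apply: negligibleS ae0 => x /= nP P; apply: nP => xt.
  by have [] := P xt.
- apply: nearW => x xt; rewrite /opK indicE mem_setE in_itv /= xt mul1r.
  rewrite /cintegral.
  under eq_Rintegral do rewrite -rmorphM /=.
  under [X in _ +i* X]eq_Rintegral do rewrite -rmorphM /=.
  by rewrite -rmorphM /= -eqphi ?ltW// [X in _ +i* X]Rintegral_eq0.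
Qed.

Lemma integral_eq_truncation t lam (phi : R -> R) : 0 < t ->
  integral_eq (truncation K t) (- t) t lam phi 1 -> forall x, x <= t ->
  phi x + lam * \int[mu]_(y in `]-oo, t[) (K (x + y) * phi y) = 1.
Proof. by move=> t0 phieq x xt; rewrite (Rintegral_truncation K0). Qed.

(** On a short interval around [y0], [f] is the quotient of the integrable
    function [K (x + y) * f y] by [K (x + y)], where [x = z - y0] makes the
    denominator close to [K z]. Finitely many shifts [x i] cover the interval;
    [S], the sum of the squares [K (x i + y) ^+ 2], is bounded below there,
    which divides by all of them at once. *)
Lemma integrable_of_kernel_mul t z (f : R -> R) : K z != 0 ->
  (forall x, mu.-integrable `]-oo, t[ (EFin \o (fun y => K (x + y) * f y))) ->
  forall a, mu.-integrable `[a, t[ (EFin \o f).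
Proof.
move=> Kz If a.
have p0 : 0 < `|K z| / 2 by rewrite divr_gt0// normr_gt0.
have [d d0 Kd] := @continuous_ucont_near _ K z z cK _ p0.
have Kpos y : `|y - z| <= d -> `|K z| / 2 <= `|K y|.
  move=> yz; have := Kd z y; rewrite lexx distrC yz => /(_ isT isT) H.
  have := ler_dist_dist (K z) (K y).
  have := ler_norm (`|K z| - `|K y|); lra.
pose n := Num.Def.archi_bound ((t - a) / d).
have cover y : a <= y < t -> exists i : nat, (i < n)%N /\ `|y - (a + i%:R * d)| <= d.
  move=> /andP[ay yt].
  have yn : y < a + n%:R * d.
    have at0 : 0 <= (t - a) / d.
      by rewrite divr_ge0 ?(ltW d0)// subr_ge0 (le_trans ay)// ltW.
    rewrite (lt_trans yt)// -ltrBlDl -ltr_pdivrMr//.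
    exact: archi_boundP.
  elim: n yn => [|m IH]; first by rewrite mul0r addr0 ltNge ay.
  have [/IH [i [im yi]] _|my] := ltP y (a + m%:R * d).
    by exists i; rewrite ltnS ltnW.
  rewrite -natr1 mulrDl mul1r addrA => ym; exists m; split => //.
  by rewrite ger0_norm ?subr_ge0// lerBlDl ltW.
pose x i := z - (a + i%:R * d).
pose S y := \sum_(i < n) K (x i + y) ^+ 2.
have Sge y : a <= y < t -> (`|K z| / 2) ^+ 2 <= S y.
  move=> /cover[i [i_n yi]].
  rewrite /S (bigD1 (Ordinal i_n))//= ler_wpDr//.
    by apply: sumr_ge0 => j _; exact: sqr_ge0.
  rewrite -[leRHS]real_normK ?num_real// lerXn2r ?nnegrE ?(ltW p0)//.
  apply: Kpos; move: yi; congr (`| _ | <= _); rewrite /x; ring.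
have cKx (v : R) : continuous (fun y : R => K (v + y)).
  move=> y; apply: (@continuous_comp _ _ _ (fun y : R => v + y) K); last exact: cK.
  by apply: cvgD; [exact: cvg_cst|exact: cvg_id].
have mKx (v : R) : measurable_fun setT (fun y : R => K (v + y)).
  exact: continuous_measurable_fun.
have mS : measurable_fun setT S.
  by apply: measurable_sum => i; apply: measurable_funX.
have iKf v : mu.-integrable `[a, t[ (EFin \o (fun y => K (v + y) * f y)).
  apply: integrableS (If v) => // y /=.
  by rewrite !in_itv /= => /andP[_ ->].
have iSf : mu.-integrable `[a, t[ (EFin \o (fun y => S y * f y)).
  have : mu.-integrable `[a, t[ (fun y => \sum_(i < n)
      ((EFin \o (fun y => K (x i + y))%R) \* (EFin \o (fun y => K (x i + y) * f y)%R))%E y)%E.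
    apply: integrable_sum => // i _; apply: integrableMr => //.
      by apply: measurable_funTS; exact: mKx.
    have [M _ KM] := bounded_truncation (x i + t) cK K0.
    apply: (@bounded_on _ _ M) => y /=; rewrite in_itv /= => /andP[_ yt].
    by have := KM (x i + y); rewrite min_l// lerD2l ltW.
  apply: eq_integrable => // y _ /=.
  rewrite sumEFin big_distrl /=; congr (_%:E); apply: eq_bigr => i _.
  by rewrite expr2 mulrA.
have c0 : 0 < (`|K z| / 2) ^+ 2 by rewrite exprn_gt0.
have Sgt0 y : a <= y < t -> 0 < S y by move=> /Sge; exact: lt_le_trans.
have := @integrableMl _ _ _ mu `[a, t[%classic _ (EFin \o (fun y => S y * f y))
  (fun y => S y `^ (-1)) iSf _ _.
move=> /(_ (measurable_itv _)) I; apply: eq_integrable (I _ _) => //.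
- move=> y; rewrite inE /= in_itv /= => /Sgt0 Sy.
  by rewrite powR_inv1 ?ltW// -EFinM mulrAC mulfV ?mul1r// gt_eqF.
- apply: measurable_funTS; exact: (measurableT_comp (measurable_powR _)).
- apply: (@bounded_on _ _ ((`|K z| / 2) ^+ 2)^-1) => y /=; rewrite in_itv /= => yt.
  have Sy := Sgt0 y yt.
  by rewrite powR_inv1 ?(ltW Sy)// gtr0_norm ?invr_gt0// lef_pV2// ?posrE// Sge.
Qed.
End EigenvalueFree.

(** * Uniqueness *)

Section IntegralOperator.
Context {R : realType}.
Notation mu := (@lebesgue_measure R).

Lemma ucont_integral_operator (K : R -> R) M a b (f : R -> R) : ucont K ->
  (forall x, `|K x| <= M) -> mu.-integrable `[a, b[ (EFin \o f) ->
  ucont (fun x => \int[mu]_(y in `[a, b[) (K (x + y) * f y)).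
Proof.
move=> uK KM If e e0.
have iKf (x : R) : mu.-integrable `[a, b[ (EFin \o (fun y => K (x + y) * f y)).
  have mK : measurable_fun setT (fun y => K (x + y)).
    apply: continuous_measurable_fun.
    exact: ucont_continuous (ucont_shift x uK).
  have := @integrableMr _ _ _ mu `[a, b[%classic (measurable_itv _)
    (fun y => K (x + y)) (EFin \o f).
  by apply => //; [exact: measurable_funTS|apply: (@bounded_on _ _ _ M)].
have inf : mu.-integrable `[a, b[ (EFin \o (fun y => `|f y|)).
  exact: (integrable_norm If).
pose A := \int[mu]_(y in `[a, b[) `|f y|.
have A0 : 0 <= A by apply: Rintegral_ge0.
have A1 : 0 < A + 1 by rewrite ltr_wpDl.
have [d d0 Kd] := uK _ (divr_gt0 e0 A1); exists d => // x y xy.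
rewrite -RintegralB//.
have iB : mu.-integrable `[a, b[ (EFin \o (fun z => K (x + z) * f z - K (y + z) * f z)).
  by apply: eq_integrable (integrableB _ (iKf x) (iKf y)).
rewrite (le_trans (le_normr_Rintegral _ iB))//.
apply: (@le_trans _ _ (\int[mu]_(z in `[a, b[) (e / (A + 1) * `|f z|))).
  apply: le_Rintegral => //.
  - exact: (integrable_norm iB).
  - by apply: eq_integrable (integrableZl _ (e / (A + 1)) inf).
  move=> z _; rewrite -mulrBl normrM ler_wpM2r//; apply: Kd.
  by rewrite opprD addrACA subrr addr0.
rewrite RintegralZl// -/A -[leRHS](divfK (lt0r_neq0 A1)) ler_wpM2l ?lerDl//.
by rewrite divr_ge0 ?(ltW e0)// ltW.
Qed.
End IntegralOperator.

Section Uniqueness.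
Context {R : realType}.
Notation mu := (@lebesgue_measure R).
Variables (K : R -> R) (t lam : R).
Hypotheses (cK : continuous K) (K0 : K3 K).
Hypothesis inj : 0 < t -> forall phi, ucont phi ->
  integral_eq (truncation K t) (- t) t lam phi 0 -> forall x, phi x = 0.

(** If [K] is not zero then [f] is locally integrable, so the right-hand side of
    the equation defines a uniformly continuous function [phi], which agrees
    with [f] up to [t]. *)
Lemma homogeneous_solution_eq0 (f : R -> R) :
  (forall x, mu.-integrable `]-oo, t[ (EFin \o (fun y => K (x + y) * f y))) ->
  (forall x, f x + lam * \int[mu]_(y in `]-oo, t[) (K (x + y) * f y) = 0) ->
  forall x, f x = 0.
Proof.
move=> If feq.
suff f0 x : x < t -> f x = 0.
  move=> x; have := feq x; rewrite Rintegral_eq0 ?mulr0 ?addr0//.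
  by move=> y /=; rewrite in_itv /= => yt; rewrite f0 ?mulr0.
have [t0|t0] := leP t 0.
  move=> xt; have := feq x; rewrite Rintegral_eq0 ?mulr0 ?addr0//.
  by move=> y /=; rewrite in_itv /= => yt; rewrite K0 ?mul0r//; lra.
have [[z Kz]|Kz] := pselect (exists z, K z != 0); last first.
  move=> xt; have := feq x; rewrite Rintegral_eq0 ?mulr0 ?addr0//.
  move=> y _; apply/eqP; rewrite mulf_eq0; apply/orP; left.
  by apply/negPn/negP => Kxy; apply: Kz; exists (x + y).
have I := integrable_of_kernel_mul cK K0 Kz If (- t).
have uK : ucont (truncation K t) by exact: ucont_truncation.
have [M _ KM] := bounded_truncation (2 * t) cK K0.
pose phi x := - lam * \int[mu]_(y in `[- t, t[) (truncation K t (x + y) * f y).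
have phiE y : y <= t -> phi y = f y.
  move=> yt; rewrite /phi -(Rintegral_truncation K0)//.
  by apply/eqP; rewrite mulNr eq_sym -addr_eq0; apply/eqP; exact: feq.
have uphi : ucont phi.
  by apply: ucontZ; exact: ucont_integral_operator uK KM I.
move=> xt; rewrite -phiE ?ltW//; apply: inj => // y.
have -> : \int[mu]_(z in `[- t, t[) (truncation K t (y + z) * phi z) =
    \int[mu]_(z in `[- t, t[) (truncation K t (y + z) * f z).
  apply: eq_Rintegral => w; rewrite inE /= in_itv /= => /andP[_ wt].
  by rewrite phiE ?ltW.
by rewrite /phi mulNr addNr.
Qed.

Lemma solution_unique Phi Phi' :
  solution K lam t Phi -> solution K lam t Phi' -> Phi = Phi'.
Proof.
move=> sP sP'; apply/funext => x; apply/eqP; rewrite -subr_eq0; apply/eqP.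
have IB y : mu.-integrable `]-oo, t[
    (EFin \o (fun z => K (y + z) * (Phi z - Phi' z))).
  apply: eq_integrable (integrableB _ (sP y).1 (sP' y).1) => // z _ /=.
  by rewrite mulrBr EFinB.
apply: (homogeneous_solution_eq0 (f := fun x => Phi x - Phi' x)) => // y.
under eq_Rintegral do rewrite mulrBr.
rewrite RintegralB//; [|exact: (sP y).1|exact: (sP' y).1].
have := (sP y).2; have := (sP' y).2; lra.
Qed.
End Uniqueness.

(** * The theorem *)

Section Main.
Context {R : realType}.
Variables (K : R -> R) (t : R).
Hypotheses (cK : continuous K) (K0 : K3 K).
Hypothesis noev : 0 < t -> ~ eigenvalue_opK K t 1 /\ ~ eigenvalue_opK K t (- 1).

Lemma no_eigenvalue_injective_pm lam : lam = 1 \/ lam = - 1 -> 0 < t ->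
  forall phi, ucont phi -> integral_eq (truncation K t) (- t) t lam phi 0 ->
  forall x, phi x = 0.
Proof.
move=> lam1 t0 phi uphi; have [ev1 evN1] := noev t0.
apply: no_eigenvalue_injective => //.
  by case: lam1 => ->; rewrite ?mulr1// mulrNN mulr1.
by case: lam1 => ->; rewrite ?opprK// rmorphN.
Qed.

Lemma solution_exists lam : lam = 1 \/ lam = - 1 -> exists Phi,
  [/\ solution K lam t Phi, det_1addK K t != 0, det_1subK K t != 0 &
   fredholm_det `]-oo, t[ (fun x y => K (x + y)) lam * Phi t =
   fredholm_det `]-oo, t[ (fun x y => K (x + y)) (- lam)].
Proof.
move=> lam1; rewrite /det_1addK /det_1subK.
have [t0|t0] := leP t 0.
  (* The kernel vanishes on the square of the half-line, so both determinants
     are 1 and the constant 1 is a solution up to [t]. *)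
  have [|Phi [sPhi Phit]] := @solution_extension _ _ cK K0 t lam (fun=> 1) (fun=> cvg_cst _).
    move=> x xt; rewrite Rintegral_eq0 ?mulr0 ?addr0// => y /=.
    by rewrite in_itv /= => yt; rewrite K0 ?mul0r//; lra.
  by exists Phi; rewrite !fredholm_det_le0// Phit mulr1 oner_eq0.
have uK : ucont (truncation K t) by exact: ucont_truncation.
have [M M1 KM] := bounded_truncation (2 * t) cK K0.
have tt : - t < t by lra.
have normlam l : l = 1 \/ l = - 1 -> `|l| = 1 :> R.
  by case=> ->; rewrite ?normrN normr1.
have neq0 l : l = 1 \/ l = - 1 -> fredholm_det `]-oo, t[ (fun x y => K (x + y)) l != 0.
  move=> l1; rewrite fredholm_det_truncation//.
  apply: (fredholm_det_neq0 uK M1 KM tt (normlam l l1)).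
  exact: no_eigenvalue_injective_pm.
have [phi [uphi phieq phidet]] := fredholm_det_hankel uK M1 KM t0
  (fun x => truncation_le0 cK K0 t0) (normlam _ lam1)
  (no_eigenvalue_injective_pm lam1 t0).
have [Phi [sPhi Phit]] := solution_extension cK K0 (ucont_continuous uphi)
  (integral_eq_truncation K0 t0 phieq).
exists Phi; split => //; [by apply: neq0; left|by apply: neq0; right|].
by rewrite !fredholm_det_truncation// Phit.
Qed.
End Main.

Theorem theorem1p4 (R : realType) (E : R[i] -> R[i]) (c : R) (K : R -> R)
    (Lam : set R) (tau : \bar R) :
  K2 E c K -> K3 K -> K4 K Lam -> K5 K tau ->
  exists Phi Psi : R -> R -> R,
    forall t : R, (t%:E < tau)%E ->
      [/\ unique (solution K 1 t) (Phi t),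
          unique (solution K (- 1) t) (Psi t),
          det_1subK K t != 0 /\ Phi t t != 0,
          m K t = 1 / Phi t t &
          m K t = Psi t t].
Proof.
move=> [_ cK _ _] K0 _ [_ noev].
have main t : exists p : (R -> R) * (R -> R), (t%:E < tau)%E ->
    [/\ unique (solution K 1 t) p.1, unique (solution K (- 1) t) p.2,
        det_1subK K t != 0 /\ p.1 t != 0,
        m K t = 1 / p.1 t & m K t = p.2 t].
  have [tt|ntt] := pselect (t%:E < tau)%E; last by exists ((fun=> 0), (fun=> 0)).
  have noevt : 0 < t -> ~ eigenvalue_opK K t 1 /\ ~ eigenvalue_opK K t (- 1).
    by move=> t0; apply: noev => //; exact: ltW.
  have uniq lam : lam = 1 \/ lam = - 1 -> forall P P',
      solution K lam t P -> solution K lam t P' -> P = P'.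
    move=> lam1; apply: solution_unique => //.
    exact: no_eigenvalue_injective_pm.
  have p1 : (1 : R) = 1 \/ (1 : R) = - 1 by left.
  have p2 : (- 1 : R) = 1 \/ (- 1 : R) = - 1 by right.
  have [P [sP d1 d2 eP]] := solution_exists cK K0 noevt p1.
  have [Q [sQ _ _ eQ]] := solution_exists cK K0 noevt p2.
  rewrite opprK in eQ; rewrite -/(det_1addK K t) -/(det_1subK K t) in eP eQ.
  have Pt : P t != 0 by apply: contraNneq d2 => P0; rewrite -eP P0 mulr0.
  exists (P, Q) => _; split => //=.
  - by split=> // P'; exact: uniq.
  - by split=> // P'; exact: uniq.
  - by rewrite /m -eP invfM mulrA mulfV// mul1r.
  - by rewrite /m -eQ mulrAC mulfV// mul1r.
have [p pP] := choice main.
by exists (fun t => (p t).1), (fun t => (p t).2) => t /pP.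
Qed.
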